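(* Let $M\subset\mathbb{R}^m$ be a bounded semialgebraic set. Each point of $\widehat{\partial}M$ has a countable basis of neighborhoods in $\beta_s^*M$.
   Context: $\mathcal{S}^*(M)$ is the ring of bounded continuous semialgebraic functions $M\to\mathbb{R}$. $\beta_s^*M$ is the set of maximal ideals of $\mathcal{S}^*(M)$ with the topology induced by the Zariski topology (basis of open sets $\{\mathfrak{m}^*: f\notin\mathfrak{m}^*\}$, $f\in\mathcal{S}^*(M)$); $M$ is identified with a dense subspace of $\beta_s^*M$ through $p\mapsto\{f\in\mathcal{S}^*(M): f(p)=0\}$, and $\partial M:=\beta_s^*M\setminus M$. Let $F_1:=\mathbb{R}((\mathtt{t}^* ))$ be the real closed field of formal Puiseux series in $\mathtt{t}$ with real coefficients, ordered so that $\mathtt{t}>0$ is infinitesimal, and $\mathbb{R}[[\mathtt{t}^*]]$ its subring of series of nonnegative order. $M_{F_1}\subset F_1^m$ denotes the extension of $M$ to $F_1$ (the set defined over $F_1$ by the same formula as $M$), and $f_{F_1}:M_{F_1}\to F_1$ the extension of a semialgebraic function $f:M\to\mathbb{R}$. A formal path in $M$ is a tuple $\alpha\in\mathbb{R}[[\mathtt{t}]]^m\cap M_{F_1}$; then $\alpha(0)\in\operatorname{Cl}_{\mathbb{R}^m}(M)$. For $f\in\mathcal{S}^*(M)$ one has $f_{F_1}(\alpha)\in\mathbb{R}[[\mathtt{t}^*]]$, and $\mathfrak{m}_\alpha^*:=\{f\in\mathcal{S}^*(M): f_{F_1}(\alpha)(0)=0\}$ is a maximal ideal of $\mathcal{S}^*(M)$,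 where $\zeta(0)$ denotes the constant term of $\zeta\in\mathbb{R}[[\mathtt{t}^*]]$. $\widehat{\partial}M\subset\partial M$ is the set of all $\mathfrak{m}_\alpha^*$ with $\alpha$ a formal path in $M$ such that $\alpha(0)\in\operatorname{Cl}_{\mathbb{R}^m}(M)\setminus M$. *)

(* Defs.v *)
From HB Require Import structures.
From mathcomp Require Import all_boot all_order all_algebra.
From mathcomp Require Import all_classical all_reals all_analysis.
From mathcomp Require Import ring lra zify.
From mathcomp Require qe_rcf.

Set Implicit Arguments.
Unset Strict Implicit.
Unset Printing Implicit Defensive.

Import Order.TTheory GRing.Theory Num.Theory.
Import numFieldNormedType.Exports.

Local Open Scope classical_set_scope.
Local Open Scope ring_scope.

Section PuiseuxDef.
Variable R : realType.

Definition pexp (q : nat) (n : int) (k : nat) : rat :=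
  (n + k%:Z)%:~R / q%:R.

(* [f r] is the coefficient of t^r; the exponents share a common
   denominator [q] and are bounded below by [n / q]. *)
Definition plevel (q : nat) (n : int) (f : rat -> R) :=
  forall r, f r != 0 -> exists k, r = pexp q n k.

Definition puiseux_support (f : rat -> R) :=
  exists q n, (0 < q)%N /\ plevel q n f.

Record puiseux := Puiseux {
  pcoef :> rat -> R;
  pcoefP : puiseux_support pcoef }.

HB.instance Definition _ := gen_eqMixin puiseux.
HB.instance Definition _ := gen_choiceMixin puiseux.

Implicit Types f g h : puiseux.

Lemma puiseux_eq f g : (forall r, f r = g r) -> f = g.
Proof.
case: f g => [f fP] [g gP] /= fg.
have E : f = g by apply/funext.
by case: _ / E gP => gP; rewrite (Prop_irrelevance fP gP).
Qed.

Lemma plevel_mulq q n f c : (0 < q)%N -> (0 < c)%N ->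
  plevel q n f -> plevel (q * c) (n * c%:Z) f.
Proof.
move=> q0 c0 fP r /fP[k ->]; exists (k * c)%N; rewrite /pexp.
rewrite natrM PoszM -mulrDl intrM.
have : (q%:R : rat) != 0 by rewrite pnatr_eq0 -lt0n.
have : (c%:R : rat) != 0 by rewrite pnatr_eq0 -lt0n.
by rewrite pmulrn => c0' q0'; field; rewrite c0' q0'.
Qed.

Lemma plevel_le q (n n' : int) (f : rat -> R) : n' <= n ->
  plevel q n f -> plevel q n' f.
Proof.
move=> nn' fP r /fP[k ->]; exists (`|n - n'| + k)%N; rewrite /pexp.
by congr (_%:~R / _); lia.
Qed.

Lemma plevel_common f g : exists q n, [/\ (0 < q)%N, plevel q n f & plevel q n g].
Proof.
have [q [n [q0 fP]]] := pcoefP f; have [q' [n' [q'0 gP]]] := pcoefP g.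
exists (q * q')%N, (Order.min (n * q') (n' * q)); split.
- by rewrite muln_gt0 q0.
- by apply: plevel_le (plevel_mulq q0 q'0 fP); lia.
- by apply: plevel_le (n' * q) _ _ _ _; [lia|rewrite mulnC; exact: plevel_mulq].
Qed.

(* the series of general term [u k] t^((n + k) / q) *)
Definition pseq_fun q (n : int) (u : nat -> R) (r : rat) : R :=
  let z := r * q%:R - n%:~R in if z \is a Num.nat then u (Num.truncn z) else 0.

Lemma pexpK q n k : (0 < q)%N -> pexp q n k * q%:R - n%:~R = k%:R.
Proof.
move=> q0; have : (q%:R : rat) != 0 by rewrite pnatr_eq0 -lt0n.
by move=> q0'; rewrite /pexp divfK// rmorphD/= addrAC subrr add0r.
Qed.

Lemma pexp_inj q n : (0 < q)%N -> injective (pexp q n).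
Proof.
move=> q0 i j ij; have := pexpK n i q0.
by rewrite ij pexpK// => /eqP; rewrite eqr_nat => /eqP.
Qed.

Lemma pseq_funE q n u k : (0 < q)%N -> pseq_fun q n u (pexp q n k) = u k.
Proof. by move=> q0; rewrite /pseq_fun pexpK// natr_nat natrK. Qed.

Lemma pseq_level q n u : (0 < q)%N -> plevel q n (pseq_fun q n u).
Proof.
move=> q0 r; rewrite /pseq_fun; case: ifP => [|_]; last by rewrite eqxx.
move=> /natrP[k kE] _; exists k; rewrite /pexp rmorphD/= -pmulrn -kE addrC subrK.
by rewrite mulfK// pnatr_eq0 -lt0n.
Qed.

Lemma plevelE q n (f : rat -> R) : (0 < q)%N -> plevel q n f ->
  forall r, f r = pseq_fun q n (fun k => f (pexp q n k)) r.
Proof.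
move=> q0 fP r; have [[k ->]|nk] := pselect (exists k, r = pexp q n k).
  by rewrite pseq_funE.
have -> : f r = 0 by apply/eqP/negPn/negP => /fP.
by apply/esym/eqP/negPn/negP => /(pseq_level q0).
Qed.

Lemma pseq_support q n u : (0 < q)%N -> puiseux_support (pseq_fun q n u).
Proof. by move=> q0; exists q, n; split => //; exact: pseq_level. Qed.

Definition pseq q n u (q0 : (0 < q)%N) := Puiseux (pseq_support n u q0).

Lemma puiseux_pseq q n f (q0 : (0 < q)%N) : plevel q n f ->
  f = pseq n (fun k => f (pexp q n k)) q0.
Proof. by move=> fP; apply: puiseux_eq; exact: plevelE. Qed.

Lemma pzero_subproof : puiseux_support (fun=> 0).
Proof. by exists 1%N, 0; split => // r; rewrite eqxx. Qed.
Definition pzero := Puiseux pzero_subproof.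

Lemma popp_subproof f : puiseux_support (fun r => - f r).
Proof.
have [q [n [q0 fP]]] := pcoefP f.
by exists q, n; split => // r; rewrite oppr_eq0; exact: fP.
Qed.
Definition popp f := Puiseux (popp_subproof f).

Lemma padd_subproof f g : puiseux_support (fun r => f r + g r).
Proof.
have [q [n [q0 fP gP]]] := plevel_common f g.
exists q, n; split => // r; have [fr0|/fP//] := eqVneq (f r) 0.
by rewrite fr0 add0r; exact: gP.
Qed.
Definition padd f g := Puiseux (padd_subproof f g).

Fact paddA : associative padd.
Proof. by move=> f g h; apply: puiseux_eq => r /=; rewrite addrA. Qed.
Fact paddC : commutative padd.
Proof. by move=> f g; apply: puiseux_eq => r /=; rewrite addrC. Qed.
Fact padd0 : left_id pzero padd.
Proof. by move=> f; apply: puiseux_eq => r /=; rewrite add0r. Qed.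
Fact paddN : left_inverse pzero popp padd.
Proof. by move=> f; apply: puiseux_eq => r /=; rewrite addNr. Qed.

HB.instance Definition _ := GRing.isZmodule.Build puiseux paddA paddC padd0 paddN.

(* Convolution: for Puiseux series the sum over all rationals has finitely
   many nonzero terms. *)
Definition pmul_fun (f g : rat -> R) (r : rat) : R :=
  \sum_(s \in [set: rat]) f s * g (r - s).

Definition cauchy (u v : nat -> R) (k : nat) : R :=
  \sum_(i < k.+1) u i * v (k - i)%N.

Lemma pexp_sub q n n' k i : (i <= k)%N ->
  pexp q (n + n') k - pexp q n i = pexp q n' (k - i).
Proof. by move=> ik; rewrite /pexp -mulrBl -rmorphB/=; congr (_%:~R / _); lia. Qed.

Lemma pexpD q n n' k i : pexp q n k + pexp q n' i = pexp q (n + n') (k + i).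
Proof. by rewrite /pexp -mulrDl -rmorphD/=; congr (_%:~R / _); lia. Qed.

Lemma pmul_pseq q n n' u v : (0 < q)%N ->
  forall r, pmul_fun (pseq_fun q n u) (pseq_fun q n' v) r =
    pseq_fun q (n + n') (cauchy u v) r.
Proof.
move=> q0 r; rewrite /pmul_fun.
have [[k ->]|nk] := pselect (exists k, r = pexp q (n + n') k).
  rewrite pseq_funE//.
  rewrite -(fsbig_widen (pexp q n @` `I_k.+1))//=.
    rewrite fsbig_image; last by move=> i j _ _; exact: pexp_inj.
    rewrite /cauchy (fsbig_ord _ _ (fun i => u i * v (k - i)%N)).
    apply: eq_fsbigr => i; rewrite inE/= ltnS => ik.
    by rewrite pexp_sub// !pseq_funE.
  move=> s /= [_ sk]; apply/eqP; rewrite mulf_eq0 -[_ || _]negbK negb_or.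
  apply/negP => /andP[/(pseq_level q0)[i iE] /(pseq_level q0)[j jE]].
  apply: sk; exists i => //; rewrite ltnS.
  suff -> : k = (i + j)%N by rewrite leq_addr.
  by apply: (@pexp_inj q (n + n') q0); rewrite -pexpD -iE -jE [RHS]addrC subrK.
rewrite fsbig1; last first.
  move=> s _; apply/eqP; rewrite mulf_eq0 -[_ || _]negbK negb_or.
  apply/negP => /andP[/(pseq_level q0)[i iE] /(pseq_level q0)[j jE]].
  by apply: nk; exists (i + j)%N; rewrite -pexpD -iE -jE [RHS]addrC subrK.
by apply/esym/eqP/negPn/negP => /(pseq_level q0).
Qed.

Lemma pmul_subproof f g : puiseux_support (pmul_fun f g).
Proof.
have [q [n [q0 fP gP]]] := plevel_common f g.
exists q, (n + n); split => //.
rewrite (puiseux_pseq q0 fP) (puiseux_pseq q0 gP)/=.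
by move=> r; rewrite pmul_pseq//; exact: pseq_level.
Qed.
Definition pmul f g := Puiseux (pmul_subproof f g).

Lemma pmulE q n n' u v (q0 : (0 < q)%N) :
  pmul (pseq n u q0) (pseq n' v q0) = pseq (n + n') (cauchy u v) q0.
Proof. by apply: puiseux_eq => r /=; rewrite pmul_pseq. Qed.

Lemma cauchyE K u v k : (k <= K)%N ->
  cauchy u v k = ((\poly_(i < K.+1) u i) * (\poly_(i < K.+1) v i))`_k.
Proof.
move=> kK; rewrite coefM; apply: eq_bigr => i _; rewrite !coef_poly.
have -> : (i < K.+1)%N by have := ltn_ord i; lia.
by have -> : (k - i < K.+1)%N by lia.
Qed.

Lemma cauchyC u v k : cauchy u v k = cauchy v u k.
Proof. by rewrite !(cauchyE _ _ (leqnn k)) mulrC. Qed.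

Lemma cauchyA u v w k : cauchy u (cauchy v w) k = cauchy (cauchy u v) w k.
Proof.
pose P (a : nat -> R) := \poly_(i < k.+1) a i.
transitivity ((P u * (P v * P w))`_k).
  rewrite coefM; apply: eq_bigr => i _; rewrite coef_poly ltn_ord.
  by rewrite (@cauchyE k) ?leq_subr.
rewrite mulrA coefM; apply: eq_bigr => i _; rewrite coef_poly.
rewrite [(k - i < _)%N]ltnS leq_subr (@cauchyE k)//.
by rewrite -ltnS.
Qed.

Lemma plevel_common3 f g h : exists q n,
  [/\ (0 < q)%N, plevel q n f, plevel q n g & plevel q n h].
Proof.
have [q [n [q0 fP gP]]] := plevel_common f g; have [q' [n' [q'0 hP]]] := pcoefP h.
exists (q * q')%N, (Order.min (n * q') (n' * q)); split.
- by rewrite muln_gt0 q0.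
- by apply: plevel_le (plevel_mulq q0 q'0 fP); lia.
- by apply: plevel_le (plevel_mulq q0 q'0 gP); lia.
- by apply: plevel_le (n' * q) _ _ _ _; [lia|rewrite mulnC; exact: plevel_mulq].
Qed.

Fact pmulC : commutative pmul.
Proof.
move=> f g; have [q [n [q0 fP gP]]] := plevel_common f g.
rewrite (puiseux_pseq q0 fP) (puiseux_pseq q0 gP) !pmulE.
by congr pseq; apply/funext => k; exact: cauchyC.
Qed.

Fact pmulA : associative pmul.
Proof.
move=> f g h; have [q [n [q0 fP gP hP]]] := plevel_common3 f g h.
rewrite (puiseux_pseq q0 fP) (puiseux_pseq q0 gP) (puiseux_pseq q0 hP) !pmulE.
by rewrite addrA; congr pseq; apply/funext => k; exact: cauchyA.
Qed.

Fact pmulDl : left_distributive pmul padd.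
Proof.
move=> f g h; have [q [n [q0 fP gP hP]]] := plevel_common3 f g h.
have E m u v : padd (pseq m u q0) (pseq m v q0) = pseq m (fun k => u k + v k) q0.
  apply: puiseux_eq => r /=; rewrite /pseq_fun; case: ifP => //.
  by rewrite addr0.
rewrite (puiseux_pseq q0 fP) (puiseux_pseq q0 gP) (puiseux_pseq q0 hP) E !pmulE E.
congr pseq; apply/funext => k; rewrite /cauchy -big_split/=.
by apply: eq_bigr => i _; rewrite mulrDl.
Qed.

Lemma pconst_subproof (c : R) : puiseux_support (fun r => if r == 0 then c else 0).
Proof.
exists 1%N, 0; split => // r; case: ifPn => [/eqP -> _|]; last by rewrite eqxx.
by exists 0%N; rewrite /pexp mul0r.
Qed.
Definition pconst c := Puiseux (pconst_subproof c).

Lemma pconst_pseq q (q0 : (0 < q)%N) c :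
  pconst c = pseq 0 (fun k => if k == 0%N then c else 0) q0.
Proof.
have fP : plevel q 0 (pconst c).
  move=> r /=; case: ifPn => [/eqP -> _|]; last by rewrite eqxx.
  by exists 0%N; rewrite /pexp mul0r.
rewrite (puiseux_pseq q0 fP); congr pseq; apply/funext => k /=.
rewrite /pexp add0r mulf_eq0 invr_eq0 -pmulrn !pnatr_eq0.
by rewrite [q == _]gtn_eqF// orbF.
Qed.

Fact pmul1 : left_id (pconst 1) pmul.
Proof.
move=> f; have [q [n [q0 fP]]] := pcoefP f.
rewrite (puiseux_pseq q0 fP) (pconst_pseq q0) pmulE add0r.
congr pseq; apply/funext => k; rewrite /cauchy big_ord_recl/= mul1r subn0.
by rewrite big1 ?addr0// => i _; rewrite mul0r.
Qed.

Fact pone_neq0 : pconst 1 != pzero.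
Proof.
apply/eqP => /(congr1 (fun f : puiseux => f 0))/= /eqP.
by rewrite oner_eq0.
Qed.

HB.instance Definition _ :=
  GRing.Zmodule_isComNzRing.Build puiseux pmulA pmulC pmul1 pmulDl pone_neq0.

Lemma plevel_lead q n f (q0 : (0 < q)%N) : plevel q n f -> f != 0 ->
  exists n' u, f = pseq n' u q0 /\ u 0%N != 0.
Proof.
move=> fP f0; have exk : exists k, f (pexp q n k) != 0.
  apply: contrapT => /forallNP nf; move/eqP: f0; apply.
  rewrite (puiseux_pseq q0 fP); apply: puiseux_eq => r /=.
  rewrite /pseq_fun; case: ifP => // _.
  by have /negP/negPn/eqP := nf (Num.truncn (r * q%:R - n%:~R)).
have [k kP kmin] := ex_minnP exk.
exists (n + k%:Z), (fun i => f (pexp q (n + k%:Z) i)); split; last first.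
  by rewrite /pexp addr0.
apply: puiseux_pseq => r fr; have [j jE] := fP _ fr.
rewrite jE in fr *; have := kmin _ fr => kj; exists (j - k)%N.
by rewrite /pexp; congr (_%:~R / _); lia.
Qed.

Lemma cauchy_inv u : u 0%N != 0 ->
  exists v, forall k, cauchy v u k = if k == 0%N then 1 else 0.
Proof.
move=> u0.
pose step (s : seq R) := rcons s (((if size s == 0%N then 1 else 0)
  - \sum_(i < size s) s`_i * u (size s - i)%N) / u 0%N).
pose S k := iter k step [::].
have sS k : size (S k) = k by elim: k => //= k IH; rewrite size_rcons IH.
have nS k i : (i < k)%N -> (S k)`_i = (S i.+1)`_i.
  elim: k => // k IH; rewrite ltnS leq_eqVlt => /predU1P[->//|ik].
  by rewrite {1}/S iterS -/(S k) nth_rcons sS ik IH.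
have lS k : (S k.+1)`_k = ((if k == 0%N then 1 else 0)
    - \sum_(i < k) (S k)`_i * u (k - i)%N) / u 0%N.
  by rewrite {1}/S iterS -/(S k) /step nth_rcons sS ltnn eqxx.
exists (fun k => (S k.+1)`_k) => k; rewrite /cauchy big_ord_recr subnn lS.
rewrite divfK// [LHS]addrC.
rewrite -[RHS](subrK (\sum_(i < k) (S i.+1)`_i * u (k - i)%N)).
congr (_ - _ + _).
by apply: eq_bigr => i _; rewrite nS.
Qed.

Lemma pmul_inv f : f != 0 -> exists g, g * f = 1.
Proof.
move=> f0; have [q [n0 [q0 fP]]] := pcoefP f.
have [n [u [-> u0]]] := plevel_lead q0 fP f0.
have [v vP] := cauchy_inv u0; exists (pseq (- n) v q0).
transitivity (pmul (pseq (- n) v q0) (pseq n u q0)) => //.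
rewrite pmulE addNr [RHS](pconst_pseq q0).
by congr pseq; apply/funext => k; exact: vP.
Qed.

Definition pinv f : puiseux := xget 0 [set g | g * f = 1].

Fact pmulVf f : f != 0 -> pinv f * f = 1.
Proof. by move=> /pmul_inv[g gf]; rewrite /pinv; case: xgetP => [_ _ ->|/(_ g)]. Qed.

Fact pinv0 : pinv 0 = 0.
Proof.
rewrite /pinv; case: xgetP => // g _ /= /eqP.
by rewrite mulr0 eq_sym oner_eq0.
Qed.

HB.instance Definition _ := GRing.ComNzRing_isField.Build puiseux pmulVf pinv0.

(* a series is positive iff its coefficient of lowest exponent is; thus
   t is positive and smaller than every positive real constant *)
Definition ppos (f : rat -> R) :=
  exists2 r, 0 < f r & forall s, s < r -> f s = 0.

Definition plt f g : bool := `[< ppos (g - f) >].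
Definition ple f g : bool := (f == g) || plt f g.
Definition pnorm f := if plt f 0 then - f else f.

Let plt0 f : plt 0 f = `[< ppos f >].
Proof. by rewrite /plt subr0. Qed.

Let ppos_pseq q n u (q0 : (0 < q)%N) : 0 < u 0%N -> ppos (pseq n u q0).
Proof.
move=> u0; exists (pexp q n 0); first by rewrite /= pseq_funE.
move=> s sn; apply/eqP/negPn/negP => /(pseq_level q0)[k kE].
move: sn; rewrite kE /pexp ltr_pM2r ?invr_gt0 ?ltr0n// ltr_int; lia.
Qed.

Let ppos_lead q n u (q0 : (0 < q)%N) : u 0%N != 0 ->
  ppos (pseq n u q0) -> 0 < u 0%N.
Proof.
move=> u0 [r fr rmin]; have [k kE] : exists k, r = pexp q n k.
  by apply: (@pseq_level q n u q0); rewrite gt_eqF.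
move: fr; rewrite kE /= pseq_funE//; case: k => // k in kE *.
have /rmin : pexp q n 0 < r.
  by rewrite kE /pexp ltr_pM2r ?invr_gt0 ?ltr0n// ltr_int; lia.
by rewrite /= pseq_funE// => /eqP; rewrite (negPf u0).
Qed.

Let ppos_neq0 f : ppos f -> f != 0.
Proof. by move=> [r fr _]; apply/eqP => f0; move: fr; rewrite f0 /= ltxx. Qed.

Fact plt0_add f g : plt 0 f -> plt 0 g -> plt 0 (f + g).
Proof.
rewrite !plt0 => /asboolP[r fr rmin] /asboolP[s gs smin]; apply/asboolP.
have [rs|sr|rs] := ltgtP r s.
- exists r => [|x xr] /=; first by rewrite smin// addr0.
  by rewrite rmin// smin ?addr0// (lt_trans xr).
- exists s => [|x xs] /=; first by rewrite rmin// add0r.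
  by rewrite smin// rmin ?addr0// (lt_trans xs).
- exists r => [|x xr] /=; first by rewrite addr_gt0// rs.
  by rewrite rmin// smin ?addr0// -rs.
Qed.

Fact plt0_mul f g : plt 0 f -> plt 0 g -> plt 0 (f * g).
Proof.
rewrite !plt0 => /asboolP fpos /asboolP gpos; apply/asboolP.
have [q [n [q0 fP gP]]] := plevel_common f g.
have [n1 [u [fE u0]]] := plevel_lead q0 fP (ppos_neq0 fpos).
have [n2 [v [gE v0]]] := plevel_lead q0 gP (ppos_neq0 gpos).
move: fpos gpos; rewrite fE gE => /(ppos_lead u0) ? /(ppos_lead v0) ?.
rewrite [_ * _]pmulE; apply: ppos_pseq.
by rewrite /cauchy big_ord1 subn0 mulr_gt0.
Qed.

Fact plt0_ngt0 f : plt 0 f -> ~~ plt f 0.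
Proof.
rewrite plt0 /plt sub0r => /asboolP[r fr rmin].
apply/asboolP => -[s /= fs smin]; have [rs|sr|rs] := ltgtP r s.
- by have /eqP := smin _ rs; rewrite oppr_eq0 gt_eqF.
- by move: fs; rewrite rmin// oppr0 ltxx.
- by move: fs; rewrite -rs oppr_gt0 ltNge ltW.
Qed.

Fact plt_sub f g : plt 0 (g - f) = plt f g.
Proof. by rewrite plt0. Qed.

Fact plt0_total f : f != 0 -> plt 0 f || plt f 0.
Proof.
move=> f0; have [q [n0 [q0 fP]]] := pcoefP f.
have [n [u [fE u0]]] := plevel_lead q0 fP f0.
rewrite plt0 /plt sub0r; move: (u0); rewrite neq_lt => /orP[un|up].
- apply/orP; right; apply/asboolP.
  have -> : - f = pseq n (fun k => - u k) q0.
    rewrite fE; apply: puiseux_eq => r /=; rewrite /pseq_fun.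
    by case: ifP => //; rewrite oppr0.
  by apply: ppos_pseq; rewrite oppr_gt0.
- by apply/orP; left; apply/asboolP; rewrite fE; exact: ppos_pseq.
Qed.

Fact pnormN f : pnorm (- f) = pnorm f.
Proof.
have [->|f0] := eqVneq f 0; first by rewrite oppr0.
have E : plt (- f) 0 = plt 0 f by rewrite /plt sub0r opprK subr0.
rewrite /pnorm E opprK.
have := plt0_total f0; case: ifPn => [/plt0_ngt0 /negPf ->//|_ /= ->//].
Qed.

Fact ple0_norm f : ple 0 f -> pnorm f = f.
Proof.
move=> /orP[/eqP <-|/plt0_ngt0 /negPf]; rewrite /pnorm; last by move=> ->.
by rewrite oppr0 if_same.
Qed.

HB.instance Definition _ := Num.IntegralDomain_isLtReal.Build puiseux
  plt0_add plt0_mul plt0_ngt0 plt_sub plt0_total pnormN ple0_norm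
  (fun _ _ => erefl).

End PuiseuxDef.


(* Boolean combinations of polynomial sign conditions are represented by the
   quantifier-free formulas of [qe_rcf]. The variable ['X_i] stands for the
   i-th coordinate when [i < n], and evaluates to [0] otherwise. *)
Definition sat (K : realDomainType) (n : nat) (phi : qe_rcf.formula K) :
    set 'rV[K]_n :=
  [set x | qe_rcf.qf_eval [tuple x ord0 i | i < n] phi].

Fixpoint map_term (A B : Type) (h : A -> B) (t : qe_rcf.term A) :
    qe_rcf.term B :=
  match t with
  | qe_rcf.Var i => qe_rcf.Var B i
  | qe_rcf.Const c => qe_rcf.Const (h c)
  | qe_rcf.NatConst k => qe_rcf.NatConst B k
  | qe_rcf.Add u v => qe_rcf.Add (map_term h u) (map_term h v)
  | qe_rcf.Opp u => qe_rcf.Opp (map_term h u)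
  | qe_rcf.NatMul u k => qe_rcf.NatMul (map_term h u) k
  | qe_rcf.Mul u v => qe_rcf.Mul (map_term h u) (map_term h v)
  | qe_rcf.Exp u k => qe_rcf.Exp (map_term h u) k
  end.

Fixpoint map_formula (A B : Type) (h : A -> B) (phi : qe_rcf.formula A) :
    qe_rcf.formula B :=
  match phi with
  | qe_rcf.Bool b => qe_rcf.Bool b
  | qe_rcf.Equal u v => qe_rcf.Equal (map_term h u) (map_term h v)
  | qe_rcf.Lt u v => qe_rcf.Lt (map_term h u) (map_term h v)
  | qe_rcf.Le u v => qe_rcf.Le (map_term h u) (map_term h v)
  | qe_rcf.And p q => qe_rcf.And (map_formula h p) (map_formula h q)
  | qe_rcf.Or p q => qe_rcf.Or (map_formula h p) (map_formula h q)
  | qe_rcf.Implies p q => qe_rcf.Implies (map_formula h p) (map_formula h q)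
  | qe_rcf.Not p => qe_rcf.Not (map_formula h p)
  end.

Section Semialgebraic.
Variable R : realType.

Definition semialgebraic (n : nat) (S : set 'rV[R]_n) :=
  exists phi, S = sat phi.

(* the extension of [S] to Puiseux series; by Tarski's transfer principle it
   does not depend on the formula [phi] chosen to define [S] *)
Definition sa_ext (n : nat) (S : set 'rV[R]_n) : set 'rV[puiseux R]_n :=
  [set x | exists2 phi, S = sat phi & sat (map_formula (@pconst R) phi) x].

Variables (m : nat) (M : set 'rV[R]_m).

Definition fun_graph (f : M -> R) : set 'rV[R]_(m + 1) :=
  [set row_mx (set_val x) (f x)%:M | x in [set: M]].

(* [fun_ext f a z] means that the extension of [f] to Puiseux series takes
   the value [z] at [a] *)
Definition fun_ext (f : M -> R) (a : 'rV[puiseux R]_m) (z : puiseux R) :=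
  sa_ext (fun_graph f) (row_mx a z%:M).

(* a subring of the pointwise ring of all functions on [M]; [continuous] is
   for the topology induced on [M] by R^m *)
Definition Sstar : set (M -> R) :=
  [set f | [/\ continuous f, bounded_fun f & semialgebraic (fun_graph f)]].

End Semialgebraic.

Arguments Sstar {R m} M.

(* [A] is meant to be a subring of [B]; its ideals are given as subsets of [B],
   and proper means different from [A] *)
Definition ideal_of (B : pzRingType) (A I : set B) :=
  [/\ I `<=` A, I 0, forall f g, I f -> I g -> I (f + g)
    & forall f g, A f -> I g -> I (f * g)].

Definition maximal_ideal_of (B : pzRingType) (A I : set B) :=
  [/\ ideal_of A I, I <> A
    & forall J, ideal_of A J -> I `<=` J -> J = I \/ J = A].

Section MaximalSpectrum.
Variables (R : realType) (m : nat) (M : set 'rV[R]_m).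

Record beta := Beta {
  beta_ideal : set (M -> R);
  beta_idealP : maximal_ideal_of (Sstar M) beta_ideal }.

HB.instance Definition _ := gen_eqMixin beta.
HB.instance Definition _ := gen_choiceMixin beta.

(* Zariski topology; these sets are stable under finite intersections, so that
   this subbase is a basis *)
HB.instance Definition _ := isSubBaseTopological.Build beta
  (Sstar M) (fun f : M -> R => [set p : beta | ~ beta_ideal p f]).

(* a point of the extension of [M] whose coordinates are formal power series,
   i.e. have only exponents in N *)
Definition formal_path (a : 'rV[puiseux R]_m) :=
  sa_ext M a /\ forall i r, a ord0 i r != 0 -> r \is a Num.nat.

Definition value_at0 (a : 'rV[puiseux R]_m) : 'rV[R]_m :=
  \row_i a ord0 i 0.

(* [z] is the value at [a] of the extension of [f]; it has nonnegative order,
   and its constant term vanishes *)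
Definition path_ideal (a : 'rV[puiseux R]_m) : set (M -> R) :=
  [set f | Sstar M f /\ exists z : puiseux R,
    [/\ fun_ext f a z, forall r, z r != 0 -> 0 <= r & z 0 = 0]].

Definition formal_boundary : set beta :=
  [set p | exists a, [/\ formal_path a,
    (closure M `\` M) (value_at0 a) & beta_ideal p = path_ideal a]].

End MaximalSpectrum.

Arguments formal_boundary {R m} M.

Definition countable_nbhs_basis (T : topologicalType) (p : T) :=
  exists B : set_system T, [/\ countable B, B `<=` nbhs p
    & forall U, nbhs p U -> exists2 V, B V & V `<=` U].

(* Main.v *)
From HB Require Import structures.
Require Import Defs.
From mathcomp Require Import all_boot all_order all_algebra.
From mathcomp Require Import all_classical all_reals all_analysis.
From mathcomp Require Import finmap ring lra zify.
From mathcomp Require qe_rcf.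

(** Let the point be the ideal m_a of a formal path a, let c_N be the jet of a
    of order N + 1, and consider the bump functions
      b(x) = sup {max(0, 1 - |x - c_N(t)| / t^N) : 0 < t <= tau},
    which vanish outside a thin tube around the arc c_N. Since a(0) is not in M,
    only parameters t bounded away from 0 matter near a given point of M; so b
    is continuous on M, and it is semialgebraic by quantifier elimination
    ([Sstar_bump]). The claim is that the open sets {q : b is not in q}, for N
    and 1/tau positive integers, form a basis of neighborhoods of m_a.

    They contain m_a ([bump_notin_path_ideal]). Conversely, let f be outside m_a
    and write 1 = h f + k with k in m_a. If |k| < 1/2 on the tube, then |f| is
    bounded below on the support of b, and every maximal ideal that contains f
    contains b ([maximal_support]): otherwise it would contain a sum of squares
    bounded below, that is, a unit. That |k| < 1/2 on a tube ([small_near_path])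
    says that the real function k is close to its value 0 at the formal path.

    To prove such statements, formal points are compared with real ones. Let x
    be a vector of power series in s = t^(1/q) satisfying a quantifier-free
    formula. Then for s small there are real vectors that satisfy the same
    formula and agree with x up to any prescribed order in s ([realize_vector]).
    Nonzero signs take care of themselves, being visible on a truncation of x.
    The polynomial equations between the coordinates are realized by induction
    on the number of coordinates ([realizable_seq]). A new coordinate which is
    transcendental over the previous ones is truncated. Otherwise, let G be a
    polynomial of least degree having it as a root: the derivative of G does not
    vanish there, so that G changes sign near the truncation and has a real root
    nearby ([root_near]), while pseudo-division by G reduces every other
    equation to equations between the previous coordinates ([algebraic_step]).

    The continuity of k is a statement with quantifiers, which is brought to the
    formal path as follows. That |k| < 1/2 on the ball of radius d around y is
    expressed by a quantifier-free formula in d and y. When y runs through the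
    real points that follow the path, its truth value is the same for all d in
    ]0, s^K], for a fixed K, because in every polynomial in d the first
    coefficient that does not vanish at the formal point dominates the following
    ones ([along_tail]). Since k is small and continuous at y, the formula holds
    for some small d, hence for d = s^K; and a tube of exponent larger than K is
    covered by these balls. *)

Set Implicit Arguments.
Unset Strict Implicit.
Unset Printing Implicit Defensive.

Import Order.TTheory GRing.Theory Num.Theory.
Import numFieldNormedType.Exports.

Local Open Scope classical_set_scope.
Local Open Scope ring_scope.

(** * First-order definable predicates over the reals *)

Section Definability.
Variable R : realType.
Implicit Types (e : seq R) (P Q : (nat -> R) -> Prop).

(** An environment is the total function [nth 0 e]: a quantified variable can
    then be pushed in front of it as the variable of index 0, the other indices
    being shifted by one, with no bound on the number of variables. *)
Definition definable P :=
  exists phi, forall e, P (nth 0 e) <-> qe_rcf.qf_eval e phi.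

Definition polynomial_fun (T : (nat -> R) -> R) :=
  exists t, forall e, T (nth 0 e) = qe_rcf.eval e t.

Fixpoint tsubst (sigma : nat -> qe_rcf.term R) (t : qe_rcf.term R) :=
  match t with
  | qe_rcf.Var i => sigma i
  | qe_rcf.Const c => qe_rcf.Const c
  | qe_rcf.NatConst k => qe_rcf.NatConst R k
  | qe_rcf.Add u v => qe_rcf.Add (tsubst sigma u) (tsubst sigma v)
  | qe_rcf.Opp u => qe_rcf.Opp (tsubst sigma u)
  | qe_rcf.NatMul u k => qe_rcf.NatMul (tsubst sigma u) k
  | qe_rcf.Mul u v => qe_rcf.Mul (tsubst sigma u) (tsubst sigma v)
  | qe_rcf.Exp u k => qe_rcf.Exp (tsubst sigma u) k
  end.

Fixpoint fsubst (sigma : nat -> qe_rcf.term R) (phi : qe_rcf.formula R) :=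
  match phi with
  | qe_rcf.Bool b => qe_rcf.Bool b
  | qe_rcf.Equal u v => qe_rcf.Equal (tsubst sigma u) (tsubst sigma v)
  | qe_rcf.Lt u v => qe_rcf.Lt (tsubst sigma u) (tsubst sigma v)
  | qe_rcf.Le u v => qe_rcf.Le (tsubst sigma u) (tsubst sigma v)
  | qe_rcf.And p q => qe_rcf.And (fsubst sigma p) (fsubst sigma q)
  | qe_rcf.Or p q => qe_rcf.Or (fsubst sigma p) (fsubst sigma q)
  | qe_rcf.Implies p q => qe_rcf.Implies (fsubst sigma p) (fsubst sigma q)
  | qe_rcf.Not p => qe_rcf.Not (fsubst sigma p)
  end.

Lemma qf_eval_fsubst sigma e e' phi :
  (forall i, e'`_i = qe_rcf.eval e (sigma i)) ->
  qe_rcf.qf_eval e (fsubst sigma phi) = qe_rcf.qf_eval e' phi.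
Proof.
move=> eE; have tE t : qe_rcf.eval e (tsubst sigma t) = qe_rcf.eval e' t.
  by elim: t => //= [u -> v ->|u ->|u ->|u -> v ->|u ->].
by elim: phi => //= [u v|u v|u v|p -> q ->|p -> q ->|p -> q ->|p ->];
  rewrite ?tE.
Qed.

Fixpoint of_ord_formula (phi : ordered_qelim.ord.formula R) : qe_rcf.formula R :=
  match phi with
  | ordered_qelim.ord.Bool b => qe_rcf.Bool b
  | ordered_qelim.ord.Equal u v =>
      qe_rcf.Equal (qe_rcf.to_rterm u) (qe_rcf.to_rterm v)
  | ordered_qelim.ord.Lt u v =>
      qe_rcf.Lt (qe_rcf.to_rterm u) (qe_rcf.to_rterm v)
  | ordered_qelim.ord.Le u v =>
      qe_rcf.Le (qe_rcf.to_rterm u) (qe_rcf.to_rterm v)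
  | ordered_qelim.ord.And p q => qe_rcf.And (of_ord_formula p) (of_ord_formula q)
  | ordered_qelim.ord.Or p q => qe_rcf.Or (of_ord_formula p) (of_ord_formula q)
  | ordered_qelim.ord.Implies p q =>
      qe_rcf.Implies (of_ord_formula p) (of_ord_formula q)
  | ordered_qelim.ord.Not p => qe_rcf.Not (of_ord_formula p)
  | _ => qe_rcf.Bool false
  end.

Lemma of_ord_formulaE e phi :
  ordered_qelim.ord.qf_form phi -> ordered_qelim.ord.rformula phi ->
  qe_rcf.qf_eval e (of_ord_formula phi) = ordered_qelim.ord.qf_eval e phi.
Proof.
elim: phi => //=.
- by move=> u v _ /andP[ru rv]; rewrite !qe_rcf.evalE !qe_rcf.to_rtermE.
- by move=> u v _ /andP[ru rv]; rewrite !qe_rcf.evalE !qe_rcf.to_rtermE.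
- by move=> u v _ /andP[ru rv]; rewrite !qe_rcf.evalE !qe_rcf.to_rtermE.
- by move=> p IHp q IHq /andP[? ?] /andP[? ?]; rewrite IHp// IHq.
- by move=> p IHp q IHq /andP[? ?] /andP[? ?]; rewrite IHp// IHq.
- by move=> p IHp q IHq /andP[? ?] /andP[? ?]; rewrite IHp// IHq.
- by move=> p IHp ? ?; rewrite IHp.
Qed.

(** Quantifier elimination removes the variable 0 in place; the remaining
    variables are renumbered afterwards. *)
Lemma exists_qf (phi : qe_rcf.formula R) : exists psi, forall e,
  qe_rcf.qf_eval e psi <-> exists x, qe_rcf.qf_eval (x :: e) phi.
Proof.
pose ex := ordered_qelim.ord.Exists 0 (qe_rcf.qfr_to_formula phi).
pose wp i bc := qe_rcf.qfr_to_formula (@qe_rcf.wproj R i bc).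
pose el := ordered_qelim.ord.quantifier_elim wp ex.
have rex : ordered_qelim.ord.rformula ex by exact: qe_rcf.rformulaF.
(* Renumbering: the variable i + 1 becomes the variable i. *)
pose up i := if i is j.+1 then qe_rcf.Var R j else qe_rcf.NatConst R 0.
exists (fsubst up (of_ord_formula el)) => e.
rewrite (@qf_eval_fsubst _ _ (0 :: e)); last by case.
have /andP[qfel rel] :=
  ordered_qelim.ord.quantifier_elim_wf (@qe_rcf.wf_QE_wproj R) rex.
rewrite of_ord_formulaE//.
have elP := ordered_qelim.ord.quantifier_elim_rformP
  (@qe_rcf.wf_QE_wproj R) (@qe_rcf.valid_QE_wproj R) (0 :: e) rex.
split=> [/elP[x] hx|[x hx]].
  exists x; rewrite qe_rcf.qf_evalE.
  by move/(ordered_qelim.ord.qf_evalP _ (qe_rcf.qf_formF phi)): hx.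
apply/elP; exists x.
apply/(ordered_qelim.ord.qf_evalP _ (qe_rcf.qf_formF phi)).
by rewrite -qe_rcf.qf_evalE.
Qed.

Lemma definable_ext P Q : (forall r, P r <-> Q r) -> definable P -> definable Q.
Proof.
by move=> PQ [phi phiP]; exists phi => e; rewrite -phiP; split=> /PQ.
Qed.

Lemma definable_ex (Q : (nat -> R) -> R -> Prop) :
  definable (fun r => Q (fun i => r i.+1) (r 0%N)) ->
  definable (fun r => exists x, Q r x).
Proof.
move=> [phi phiP]; have [psi psiP] := exists_qf phi.
exists psi => e; apply: iff_trans (iff_sym (psiP e)).
by split=> -[x hx]; exists x; apply/(phiP (x :: e)).
Qed.

Lemma definable_not P : definable P -> definable (fun r => ~ P r).
Proof.
move=> [phi phiP]; exists (qe_rcf.Not phi) => e /=.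
by rewrite phiP; split=> /negP.
Qed.

Lemma definable_and P Q : definable P -> definable Q ->
  definable (fun r => P r /\ Q r).
Proof.
move=> [phi phiP] [psi psiP]; exists (qe_rcf.And phi psi) => e /=.
by rewrite phiP psiP; split=> /andP.
Qed.

Lemma definable_or P Q : definable P -> definable Q ->
  definable (fun r => P r \/ Q r).
Proof.
move=> [phi phiP] [psi psiP]; exists (qe_rcf.Or phi psi) => e /=.
by rewrite phiP psiP; split=> /orP.
Qed.

Lemma definable_imp P Q : definable P -> definable Q ->
  definable (fun r => P r -> Q r).
Proof.
move=> dP dQ; apply: definable_ext (definable_or (definable_not dP) dQ) => r.
by split=> [[]//|PQ]; have [/PQ|] := pselect (P r); [right|left].
Qed.

Lemma definable_all (Q : (nat -> R) -> R -> Prop) :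
  definable (fun r => Q (fun i => r i.+1) (r 0%N)) ->
  definable (fun r => forall x, Q r x).
Proof.
move=> dQ; have := definable_not (definable_ex (Q := fun r x => ~ Q r x)
  (definable_not dQ)).
apply: definable_ext => r; split=> [nQ x|Qr [x]]; last exact.
by apply: contrapT => nQx; apply: nQ; exists x.
Qed.

Lemma definable_true : definable (fun=> True).
Proof. by exists (qe_rcf.Bool true) => e. Qed.

Lemma definable_forall_fin (I : finType) (P : I -> (nat -> R) -> Prop) :
  (forall i, definable (P i)) -> definable (fun r => forall i, P i r).
Proof.
move=> dP; have : definable (fun r => forall i, i \in enum I -> P i r).
  elim: (enum I) => [|i s IH]; first exact: definable_ext definable_true.
  apply: definable_ext (definable_and (dP i) IH) => r; split.
    by move=> [Pi Ps] j; rewrite inE => /predU1P[->|/Ps].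
  move=> Ps; split; first by apply: Ps; rewrite mem_head.
  by move=> j js; apply: Ps; rewrite inE js orbT.
by apply: definable_ext => r; split=> Ps i //; apply: Ps; rewrite mem_enum.
Qed.

Section Atoms.
Implicit Types S T : (nat -> R) -> R.

Lemma polynomial_var i : polynomial_fun (fun r => r i).
Proof. by exists (qe_rcf.Var R i). Qed.

Lemma polynomial_cst c : polynomial_fun (fun=> c).
Proof. by exists (qe_rcf.Const c). Qed.

Lemma polynomialD S T : polynomial_fun S -> polynomial_fun T ->
  polynomial_fun (fun r => S r + T r).
Proof.
by move=> [s sE] [t tE]; exists (qe_rcf.Add s t) => e /=; rewrite sE tE.
Qed.

Lemma polynomialN S : polynomial_fun S -> polynomial_fun (fun r => - S r).
Proof. by move=> [s sE]; exists (qe_rcf.Opp s) => e /=; rewrite sE. Qed.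

Lemma polynomialM S T : polynomial_fun S -> polynomial_fun T ->
  polynomial_fun (fun r => S r * T r).
Proof.
by move=> [s sE] [t tE]; exists (qe_rcf.Mul s t) => e /=; rewrite sE tE.
Qed.

Lemma polynomialX S n : polynomial_fun S -> polynomial_fun (fun r => S r ^+ n).
Proof. by move=> [s sE]; exists (qe_rcf.Exp s n) => e /=; rewrite sE. Qed.

Lemma polynomial_horner (p : {poly R}) S : polynomial_fun S ->
  polynomial_fun (fun r => p.[S r]).
Proof.
move=> dS; elim/poly_ind: p => [|p c dp].
  by exists (qe_rcf.Const 0) => e; rewrite horner0.
have [s sE] := polynomialD (polynomialM dp dS) (polynomial_cst c).
by exists s => e; rewrite hornerMXaddC sE.
Qed.

Lemma definable_eq S T : polynomial_fun S -> polynomial_fun T ->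
  definable (fun r => S r = T r).
Proof.
move=> [s sE] [t tE]; exists (qe_rcf.Equal s t) => e /=.
by rewrite sE tE; split=> /eqP.
Qed.

Lemma definable_lt S T : polynomial_fun S -> polynomial_fun T ->
  definable (fun r => S r < T r).
Proof.
by move=> [s sE] [t tE]; exists (qe_rcf.Lt s t) => e /=; rewrite sE tE.
Qed.

Lemma definable_le S T : polynomial_fun S -> polynomial_fun T ->
  definable (fun r => S r <= T r).
Proof.
by move=> [s sE] [t tE]; exists (qe_rcf.Le s t) => e /=; rewrite sE tE.
Qed.

End Atoms.

Lemma definable_sa n (S : set 'rV[R]_n) (T : 'I_n -> (nat -> R) -> R) :
  semialgebraic S -> (forall i, polynomial_fun (T i)) ->
  definable (fun r => S (\row_i T i r)).
Proof.
move=> [phi ->] /choice[t tE].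
pose sigma i := if insub i is Some j then t j else qe_rcf.NatConst R 0.
exists (fsubst sigma phi) => e.
rewrite (@qf_eval_fsubst _ _ [tuple (\row_i T i (nth 0 e)) ord0 i | i < n])//.
move=> i; rewrite /sigma; case: insubP => [j _ <-|ni] /=.
  by rewrite (nth_map j) ?size_enum_ord// nth_ord_enum mxE tE.
by rewrite nth_default// size_map size_enum_ord leqNgt.
Qed.

Lemma sa_definable n (S : set 'rV[R]_n) P : definable P ->
  (forall r, P r <-> S (\row_(i < n) r i)) -> semialgebraic S.
Proof.
move=> [phi phiP] PS; exists phi; apply/seteqP; split=> x /=.
- move=> Sx; apply/phiP/PS; congr S: Sx; apply/rowP => i.
  by rewrite mxE (nth_map i) ?size_enum_ord// nth_ord_enum.
- move=> /phiP/PS; congr S; apply/rowP => i.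
  by rewrite mxE (nth_map i) ?size_enum_ord// nth_ord_enum.
Qed.

(** The coordinates are quantified one after the other. The innermost quantifier
    binds the coordinate 0, so that the coordinates come out in increasing order
    in front of the environment. *)
Lemma definable_exv n (Q : (nat -> R) -> 'rV[R]_n -> Prop) :
  definable (fun r => Q (fun i => r (n + i)%N) (\row_(i < n) r i)) ->
  definable (fun r => exists v, Q r v).
Proof.
elim: n Q => [|n IH] Q dQ.
  apply: definable_ext dQ => r; split=> [|[v]]; first by eexists; eassumption.
  by congr Q; apply/rowP; case.
pose cons x (v : 'rV[R]_n) :=
  \row_(i < n.+1) (if unlift ord0 i is Some j then v ord0 j else x).
have consE (r : nat -> R) :
    \row_(i < n.+1) r i = cons (r 0%N) (\row_(i < n) r i.+1).
  by apply/rowP => i; rewrite !mxE; case: unliftP => [j ->|->]; rewrite ?mxE.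
have : definable (fun r => exists v x, Q r (cons x v)).
  apply/IH/(definable_ex (Q := fun r x => Q (fun i => r (n + i)%N)
    (cons x (\row_(i < n) r i)))).
  by apply: definable_ext dQ => r; rewrite consE.
apply: definable_ext => r; split=> [[v [x Qr]]|[v Qr]]; first by exists (cons x v).
exists (\row_i v ord0 (lift ord0 i)), (v ord0 ord0); congr Q: Qr.
by apply/rowP => i; rewrite !mxE; case: unliftP => [j ->|->]; rewrite ?mxE.
Qed.

Lemma definable_allv n (Q : (nat -> R) -> 'rV[R]_n -> Prop) :
  definable (fun r => Q (fun i => r (n + i)%N) (\row_(i < n) r i)) ->
  definable (fun r => forall v, Q r v).
Proof.
move=> dQ; have := definable_not (definable_exv (Q := fun r v => ~ Q r v)
  (definable_not dQ)).
apply: definable_ext => r; split=> [nQ v|Qr [v]]; last exact.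
by apply: contrapT => nQv; apply: nQ; exists v.
Qed.

End Definability.

(** * Orders of magnitude at the right of zero *)

Section SmallO.
Variable R : realType.
Implicit Types (u v : R -> R) (p : {poly R}).

Definition bigO N u :=
  exists C, \forall s \near (0 : R)^'+, `|u s| <= C * s ^+ N.

Lemma near0_gt0 : \forall s \near (0 : R)^'+, 0 < s.
Proof. exact: nbhs_right_gt. Qed.

Lemma near0_lt (c : R) : 0 < c -> \forall s \near (0 : R)^'+, s < c.
Proof. exact: nbhs_right_lt. Qed.

Lemma bigO_eq N u v : (\forall s \near (0 : R)^'+, u s = v s) ->
  bigO N u -> bigO N v.
Proof.
move=> uv [C uC]; exists C; near=> s.
by rewrite -(near uv s)//; near: s.
Unshelve. all: by end_near. Qed.

Lemma bigO0 N : bigO N (fun=> 0).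
Proof. by exists 0; near=> s; rewrite normr0 mul0r. Unshelve. all: by end_near. Qed.

Lemma bigOD N u v : bigO N u -> bigO N v -> bigO N (fun s => u s + v s).
Proof.
move=> [C uC] [D vD]; exists (C + D); near=> s.
rewrite mulrDl (le_trans (ler_normD _ _))// lerD//; by near: s.
Unshelve. all: by end_near. Qed.

Lemma bigOM M N u v : bigO M u -> bigO N v -> bigO (M + N) (fun s => u s * v s).
Proof.
move=> [C uC] [D vD]; exists (C * D); near=> s.
by rewrite normrM exprD mulrACA ler_pM//; near: s.
Unshelve. all: by end_near. Qed.

Lemma bigOX N : bigO N (fun s => s ^+ N).
Proof.
exists 1; near=> s; have s0 : 0 < s by near: s; exact: near0_gt0.
by rewrite mul1r ger0_norm// exprn_ge0// ltW.
Unshelve. all: by end_near. Qed.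

Lemma bigO_cst c : bigO 0 (fun=> c).
Proof. by exists `|c|; near=> s; rewrite expr0 mulr1. Unshelve. all: by end_near. Qed.

Lemma bigO_le M N u : (N <= M)%N -> bigO M u -> bigO N u.
Proof.
move=> NM [C uC]; exists `|C|; near=> s.
have s0 : 0 < s by near: s; exact: near0_gt0.
have s1 : s < 1 by near: s; exact: near0_lt.
have /le_trans->// : `|u s| <= C * s ^+ M by near: s.
rewrite (le_trans (ler_wpM2r (exprn_ge0 _ (ltW s0)) (ler_norm C)))//.
by rewrite ler_wpM2l// ler_wiXn2l// ltW.
Unshelve. all: by end_near. Qed.

Lemma bigO_small N u c : 0 < c -> bigO N.+1 u ->
  \forall s \near (0 : R)^'+, `|u s| <= c * s ^+ N.
Proof.
move=> c0 [C uC]; near=> s.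
have s0 : 0 < s by near: s; exact: near0_gt0.
have sc : s < c / (`|C| + 1).
  by near: s; apply: near0_lt; rewrite divr_gt0// ltr_wpDl.
have /le_trans->// : `|u s| <= C * s ^+ N.+1 by near: s.
rewrite exprS mulrA ler_wpM2r ?exprn_ge0 ?(ltW s0)//.
move: sc; rewrite ltr_pdivlMr ?ltr_wpDl// => /ltW; apply: le_trans.
by rewrite mulrC ler_wpM2l ?(ltW s0)// (le_trans (ler_norm C))// lerDl.
Unshelve. all: by end_near. Qed.

(** The argument only has to be bounded near 0: this is what lets a polynomial
    be evaluated at an approximation of a series instead of at the parameter. *)
Lemma bigO_horner p u : bigO 0 u -> bigO 0 (fun s => p.[u s]).
Proof.
move=> u0; elim/poly_ind: p => [|p c IH].
  by apply: bigO_eq (bigO0 0); near=> s; rewrite horner0.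
apply: bigO_eq (bigOD (bigOM IH u0) (bigO_cst c)).
by near=> s; rewrite hornerMXaddC.
Unshelve. all: by end_near. Qed.

Lemma bigO_id : bigO 0 id.
Proof. exact: bigO_le (bigOX 1). Qed.

Lemma bigO_poly N p : (forall k, (k < N)%N -> p`_k = 0) ->
  bigO N (fun s => p.[s]).
Proof.
move=> p0; have pE : p = drop_poly N p * 'X^N.
  rewrite -[LHS](poly_take_drop N) -[RHS]add0r; congr (_ + _).
  by apply/polyP => i; rewrite coef_take_poly coef0; case: ltnP => // /p0.
rewrite pE; apply: bigO_eq (bigOM (bigO_horner (drop_poly N p) bigO_id) (bigOX N)).
by near=> s; rewrite hornerM hornerXn.
Unshelve. all: by end_near. Qed.

End SmallO.

(** * Power series in a root of the parameter, and their truncations *)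

Section Truncation.
Variables (R : realType) (q : nat) (q_gt0 : (0 < q)%N).
Local Notation F := (puiseux R).
Implicit Types (f g h : F) (u v : R -> R).

(** Series in the uniformizer s = t^(1/q): all the exponents are nonnegative
    multiples of 1/q. *)
Definition power_series g := plevel q 0 g.

Definition scoef g k := g (pexp q 0 k).

Lemma power_seriesE g : power_series g -> g = pseq 0 (scoef g) q_gt0.
Proof. exact: puiseux_pseq. Qed.

Lemma scoef_pseq w : scoef (pseq 0 w q_gt0) =1 w.
Proof. by move=> k; exact: pseq_funE. Qed.

Lemma power_series0 : power_series 0.
Proof. by move=> r /=; rewrite eqxx. Qed.

Lemma power_series_cst c : power_series (pconst c).
Proof. by rewrite (pconst_pseq q_gt0) ; exact: pseq_level. Qed.

Lemma power_seriesD f g :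
  power_series f -> power_series g -> power_series (f + g).
Proof.
move=> fS gS r /=; have [fr0|/fS//] := eqVneq (f r) 0.
by rewrite fr0 add0r => /gS.
Qed.

Lemma mul_pseq f g : power_series f -> power_series g ->
  f * g = pseq 0 (Defs.cauchy (scoef f) (scoef g)) q_gt0.
Proof.
move=> fS gS; rewrite {1}(power_seriesE fS) {1}(power_seriesE gS).
by rewrite -[0 in RHS]addr0 -pmulE.
Qed.

Lemma power_seriesM f g :
  power_series f -> power_series g -> power_series (f * g).
Proof. by move=> fS gS; rewrite mul_pseq//; exact: pseq_level. Qed.

Lemma scoefM f g k : power_series f -> power_series g ->
  scoef (f * g) k = Defs.cauchy (scoef f) (scoef g) k.
Proof. by move=> fS gS; rewrite mul_pseq// scoef_pseq. Qed.

Lemma scoef_cst c k : scoef (pconst c) k = if k == 0%N then c else 0.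
Proof. by rewrite (pconst_pseq q_gt0) scoef_pseq. Qed.

Lemma series_lead g : power_series g -> g != 0 ->
  exists2 k, scoef g k != 0 & forall j, (j < k)%N -> scoef g j = 0.
Proof.
move=> gS g0; have exk : exists k, scoef g k != 0.
  apply: contrapT => /forallNP ng; move/eqP: g0; apply.
  rewrite (power_seriesE gS); apply: puiseux_eq => r /=.
  rewrite /pseq_fun; case: ifP => // _.
  by have /negP/negPn/eqP := ng (Num.truncn (r * q%:R - 0%:~R)).
have [k k0 kmin] := ex_minnP exk; exists k => // j jk.
by apply/eqP/negPn/negP => /kmin; rewrite leqNgt jk.
Qed.

Lemma pexp_lt j k : (pexp q 0 j < pexp q 0 k) = (j < k)%N.
Proof. by rewrite /pexp ltr_pM2r ?invr_gt0 ?ltr0n// ltr_int !add0r. Qed.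

Lemma pos_lead g : power_series g -> 0 < g ->
  exists2 k, 0 < scoef g k & forall j, (j < k)%N -> scoef g j = 0.
Proof.
move=> gS; have -> : (0 < g) = plt 0 g by [].
rewrite /plt subr0 => /asboolP[r gr rmin].
have [k kE] : exists k, r = pexp q 0 k by apply: gS; rewrite gt_eqF.
exists k => [|j jk]; first by rewrite /scoef -kE.
by apply: rmin; rewrite kE pexp_lt.
Qed.

Definition trunc N g : {poly R} := \poly_(k < N) scoef g k.

(** The real function [u] of s has the expansion [g] up to order [N], where s =
    t^(1/q). *)
Definition approx N u g := bigO N (fun s => u s - (trunc N g).[s]).

Lemma approx_eq N u v g : (\forall s \near (0 : R)^'+, u s = v s) ->
  approx N u g -> approx N v g.
Proof.
move=> uv; apply: bigO_eq; near=> s.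
by congr (_ - _); near: s.
Unshelve. all: by end_near. Qed.

Lemma approx_le M N u g : (N <= M)%N -> approx M u g -> approx N u g.
Proof.
move=> NM uM; have h : bigO N (fun s => (trunc M g - trunc N g).[s]).
  apply: bigO_poly => k kN; rewrite coefB !coef_poly kN (leq_trans kN NM).
  exact: subrr.
apply: bigO_eq (bigOD (bigO_le NM uM) h); near=> s.
by rewrite hornerD hornerN addrA subrK.
Unshelve. all: by end_near. Qed.

Lemma approx_trunc N g : approx N (fun s => (trunc N g).[s]) g.
Proof.
by apply: bigO_eq (bigO0 R N); near=> s; rewrite subrr.
Unshelve. all: by end_near. Qed.

Lemma approxD N u v f g : approx N u f -> approx N v g ->
  approx N (fun s => u s + v s) (f + g).
Proof.
move=> uf vg; apply: bigO_eq (bigOD uf vg); near=> s.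
have -> : trunc N (f + g) = trunc N f + trunc N g.
  by apply/polyP => k; rewrite coefD !coef_poly; case: ifP => //; rewrite addr0.
by rewrite hornerD opprD addrACA.
Unshelve. all: by end_near. Qed.

Lemma approx_bounded N u g : approx N u g -> bigO 0 u.
Proof.
move=> ug; have := bigOD (bigO_le (leq0n N) ug) (bigO_horner (trunc N g) (bigO_id R)).
by apply: bigO_eq; near=> s; rewrite subrK.
Unshelve. all: by end_near. Qed.

(** Expanding the product of the approximations leaves, besides products of an
    error of order N with a bounded factor, the difference between the product
    of the truncations and the truncation of the product, which is divisible by
    s^N. *)
Lemma approxM N u v f g : power_series f -> power_series g ->
  approx N u f -> approx N v g -> approx N (fun s => u s * v s) (f * g).
Proof.
move=> fS gS uf vg.
have h : bigO N (fun s => (trunc N f * trunc N g - trunc N (f * g)).[s]).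
  apply: bigO_poly => k kN; rewrite coefB coef_poly kN scoefM// coefM.
  apply/eqP; rewrite subr_eq0; apply/eqP; apply: eq_bigr => i _.
  by rewrite !coef_poly !(leq_ltn_trans _ kN) ?leq_subr// -ltnS.
have uvg := bigOM (bigO_horner (trunc N f) (bigO_id R)) vg.
have := bigOM uf (approx_bounded vg); rewrite addn0 => ufv.
apply: bigO_eq (bigOD (bigOD ufv uvg) h); near=> s.
by rewrite !(hornerD, hornerN, hornerM); ring.
Unshelve. all: by end_near. Qed.

Lemma approx_cst N c : approx N (fun=> c) (pconst c).
Proof.
have h : bigO N (fun s => (c%:P - trunc N (pconst c)).[s]).
  apply: bigO_poly => k kN; rewrite coefB coefC coef_poly kN scoef_cst.
  exact: subrr.
by apply: bigO_eq h; near=> s; rewrite hornerD hornerN hornerC.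
Unshelve. all: by end_near. Qed.

Lemma approx0 N : approx N (fun=> 0) 0.
Proof.
apply: bigO_eq (bigO0 R N); near=> s.
have -> : trunc N 0 = 0 by apply/polyP => k; rewrite coef_poly coef0 if_same.
by rewrite horner0 subr0.
Unshelve. all: by end_near. Qed.

Lemma approx0_bigO N u : approx N u 0 -> bigO N u.
Proof.
apply: bigO_eq; near=> s.
have -> : trunc N 0 = 0 by apply/polyP => k; rewrite coef_poly coef0 if_same.
by rewrite horner0 subr0.
Unshelve. all: by end_near. Qed.

(** An approximation up to an order beyond the valuation [k] sees the leading
    term; hence it has the sign of the series and is bounded below by a multiple
    of s^k. *)
Lemma approx_lead N k u g : approx N u g -> (k < N)%N ->
  (forall j, (j < k)%N -> scoef g j = 0) ->
  bigO k.+1 (fun s => u s - scoef g k * s ^+ k).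
Proof.
move=> ug kN g0; apply: bigO_eq (approx_le kN ug); near=> s.
have -> : trunc k.+1 g = scoef g k *: 'X^k.
  apply/polyP => j; rewrite coef_poly coefZ coefXn ltnS leq_eqVlt.
  case: eqVneq => [->|_] /=; first by rewrite mulr1.
  by rewrite mulr0; case: ifP => // /g0.
by rewrite hornerZ hornerXn.
Unshelve. all: by end_near. Qed.

Lemma approx_neq0 N k u g : approx N u g -> (k < N)%N ->
  (forall j, (j < k)%N -> scoef g j = 0) -> scoef g k != 0 ->
  \forall s \near (0 : R)^'+, `|scoef g k| / 2 * s ^+ k <= `|u s|.
Proof.
move=> ug kN g0 gk.
have g2 : 0 < `|scoef g k| / 2 by rewrite divr_gt0 ?normr_gt0.
apply: filterS2 (near0_gt0 R) (bigO_small g2 (approx_lead ug kN g0)) => s s0 us.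
have := lerB_dist (scoef g k * s ^+ k) (u s); rewrite distrC normrM.
by rewrite [ `|s ^+ k|]ger0_norm ?exprn_ge0 ?(ltW s0)//; lra.
Qed.

End Truncation.

(** * Realizing algebraic relations between power series at real points *)

Section BigOPoly.
Variables (R : realType) (A : nzRingType) (e : R -> {rmorphism A -> R}).
Hypothesis e_bounded : forall w, bigO 0 (e ^~ w).

Lemma bigO_map_horner (y : R -> R) P :
  bigO 0 y -> bigO 0 (fun s => (map_poly (e s) P).[y s]).
Proof.
move=> y0; elim/poly_ind: P => [|P c IH].
  apply: bigO_eq (bigO0 R 0); near=> s.
  by rewrite rmorph0 horner0.
apply: bigO_eq (bigOD (bigOM IH y0) (e_bounded c)); near=> s.
by rewrite rmorphD rmorphM/= map_polyX map_polyC hornerMXaddC.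
Unshelve. all: by end_near. Qed.

(** The polynomial varies with s, through the ring morphism [e s]; the point is
    that its Taylor remainder stays bounded as s tends to 0. *)
Lemma taylor2_bigO (y h : R -> R) P : bigO 0 y -> bigO 0 h ->
  exists2 r, bigO 0 r & forall s, (map_poly (e s) P).[y s + h s] =
    (map_poly (e s) P).[y s] + h s * (map_poly (e s) P^`()).[y s]
    + h s ^+ 2 * r s.
Proof.
move=> y0 h0; elim/poly_ind: P => [|P c [r r0 IH]].
  exists (fun=> 0) => [|s]; first exact: bigO0.
  by rewrite deriv0 !rmorph0 !horner0; ring.
exists (fun s => r s * (y s + h s) + (map_poly (e s) P^`()).[y s]) => [|s].
  by apply: bigOD (bigO_map_horner _ y0); apply: bigOM r0 (bigOD y0 h0).
rewrite derivMXaddC !(rmorphD, rmorphM)/= map_polyX map_polyC.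
by rewrite !(hornerMXaddC, hornerD, hornerM, hornerX, hornerC) IH; ring.
Qed.

End BigOPoly.

Section Families.
Variables (R : realType) (q : nat) (q_gt0 : (0 < q)%N).
Local Notation F := (puiseux R).

Section Def.
Variables (A : nzRingType) (c : R -> A) (ev : {rmorphism A -> F}).

(** [A] stands for a polynomial ring over the reals, with constants [c], and
    [ev] evaluates it at some power series. A family is a choice, for every real
    s, of a real point [e s] of [A] which approximates [ev] up to order [N] as s
    tends to 0 and which, for s small, satisfies exactly the relations in [Z]. *)
Definition family (Z : seq A) N (e : R -> {rmorphism A -> R}) :=
  [/\ forall s x, e s (c x) = x,
      forall w, approx q N (e ^~ w) (ev w)
    & forall z, z \in Z -> \forall s \near (0 : R)^'+, e s z = 0].

(** A weak form of Artin approximation: finitely many polynomial relations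
    between power series are satisfied by real points that follow these series
    up to any given order. *)
Definition realizable := forall (Z : seq A) N, (forall z, z \in Z -> ev z = 0) ->
  exists e, family Z N e.

End Def.

Section Step.
Variables (A : idomainType) (c : R -> A) (ev : {rmorphism A -> F}) (beta : F).
Hypotheses (ev_series : forall w, power_series q (ev w))
  (beta_series : power_series q beta).

Implicit Types P : {poly A}.

Definition ev_ext : {rmorphism {poly A} -> F} := horner_eval beta \o map_poly ev.

Lemma ev_ext_series P : power_series q (ev_ext P).
Proof.
elim/poly_ind: P => [|P x IH].
  by rewrite rmorph0; exact: power_series0.
rewrite rmorphD rmorphM/= /horner_eval/= map_polyX map_polyC hornerX hornerC.
apply: power_seriesD; last exact: ev_series.
exact: (power_seriesM q_gt0 IH beta_series).
Qed.

Lemma approx_ext N (e : R -> {rmorphism A -> R}) y P :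
  (forall w, approx q N (e ^~ w) (ev w)) -> approx q N y beta ->
  approx q N (fun s => (map_poly (e s) P).[y s]) (ev_ext P).
Proof.
move=> eN yN; elim/poly_ind: P => [|P x IH].
  rewrite rmorph0; apply: approx_eq (approx0 _ q N); near=> s.
  by rewrite rmorph0 horner0.
rewrite rmorphD rmorphM/= /horner_eval/= map_polyX map_polyC hornerX hornerC.
have ePy := approxM q_gt0 (@ev_ext_series P) beta_series IH yN.
apply: approx_eq (approxD ePy (eN x)); near=> s.
by rewrite rmorphD rmorphM/= map_polyX map_polyC hornerMXaddC.
Unshelve. all: by end_near. Qed.

Lemma near_map_poly0 (e : R -> {rmorphism A -> R}) P :
  (forall i, \forall s \near (0 : R)^'+, e s P`_i = 0) ->
  \forall s \near (0 : R)^'+, map_poly (e s) P = 0.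
Proof.
move=> P0; have : \forall s \near (0 : R)^'+, forall i : 'I_(size P), e s P`_i = 0.
  exact: filter_forall.
apply: filterS => s es0; apply/polyP => i; rewrite coef_map coef0.
have [iP|iP] := ltnP i (size P); first exact: (es0 (Ordinal iP)).
by rewrite nth_default//; exact: rmorph0.
Qed.

Let coefs (Z : seq {poly A}) : seq A := flatten [seq (P : seq A) | P <- Z].

Let coefs0 (e : R -> {rmorphism A -> R}) Z P :
  (forall z, z \in coefs Z -> \forall s \near (0 : R)^'+, e s z = 0) ->
  P \in Z -> \forall s \near (0 : R)^'+, map_poly (e s) P = 0.
Proof.
move=> eZ PZ; apply: near_map_poly0 => i.
have [iP|iP] := ltnP i (size P); last first.
  by near=> s; rewrite nth_default//; exact: rmorph0.
apply: eZ; apply/flattenP; exists (P : seq A); last exact: mem_nth.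
by apply/mapP; exists P.
Unshelve. all: by end_near. Qed.

Let coefs_ker Z : (forall P, P \in Z -> map_poly ev P = 0) ->
  forall z, z \in coefs Z -> ev z = 0.
Proof.
move=> evZ z /flattenP[_ /mapP[P /evZ P0 ->]] /(nthP 0)[i _ <-].
by rewrite -coef_map P0 coef0.
Qed.

Let ext (e : R -> {rmorphism A -> R}) (y : R -> R) s : {rmorphism {poly A} -> R} :=
  horner_eval (y s) \o map_poly (e s).

(** When [beta] satisfies no relation over [A], every relation imposed on the
    extended point is one on coefficients, and the truncations of [beta] can be
    taken as values of the new coordinate. *)
Lemma generic_step :
  (forall P, ev_ext P = 0 -> map_poly ev P = 0) ->
  realizable c ev -> realizable (fun x => (c x)%:P) ev_ext.
Proof.
move=> gen IH Z N evZ.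
have Z0 P : P \in Z -> map_poly ev P = 0 by move=> /evZ; exact: gen.
have [e [ec eN eZ]] := IH (coefs Z) N (coefs_ker Z0).
exists (ext e (fun s => (trunc q N beta).[s])); split.
- by move=> s x /=; rewrite /horner_eval/= map_polyC hornerC; exact: ec.
- by move=> P; apply: approx_ext => //; exact: approx_trunc.
- move=> P PZ; have := coefs0 eZ PZ; apply: filterS => s es0 /=.
  by rewrite /horner_eval/= es0 horner0.
Qed.

(** The minimal polynomial of [beta] up to a factor, with denominators cleared.
    Its coefficients of degree beyond that of its image are dropped, so that its
    leading coefficient does not vanish under [ev], and a multiple of a relation
    by a power of it can be simplified. *)
Lemma minimal_relation P : ev_ext P = 0 -> map_poly ev P != 0 ->
  exists G : {poly A}, [/\ ev_ext G = 0, size (map_poly ev G) = size G, G != 0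
    & forall H : {poly A}, ev_ext H = 0 -> (size H < size G)%N -> map_poly ev H = 0].
Proof.
move=> P0 evP.
pose Q n := `[< exists2 H : {poly A}, ev_ext H = 0
                  & map_poly ev H != 0 /\ size (map_poly ev H) = n >].
have exQ : exists n, Q n by exists (size (map_poly ev P)); apply/asboolP; exists P.
have [n /asboolP[H H0 [evH nE]] nmin] := ex_minnP exQ.
pose G := take_poly n H.
have GE : map_poly ev G = map_poly ev H.
  apply/polyP => i; rewrite !coef_map coef_take_poly -nE.
  case: ltnP => iH; first by [].
  by rewrite -coef_map nth_default//; exact: rmorph0.
have sG : size G = n.
  apply/eqP; rewrite eqn_leq size_take_poly -nE -GE /=.
  exact: size_poly.
exists G; split.
- by rewrite -H0 /= /horner_eval GE.
- by rewrite GE nE sG.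
- by apply: contraNneq evH => G0; rewrite -GE G0; apply/eqP; exact: rmorph0.
- move=> K K0; rewrite sG => Kn; apply/eqP/negPn/negP => evK.
  have : Q (size (map_poly ev K)) by apply/asboolP; exists K.
  by move/nmin; rewrite leqNgt (leq_ltn_trans (size_poly _ _) Kn).
Qed.

(** Newton's method, replaced by the intermediate value theorem. The value D of
    G' at the series is nonzero, of valuation k. At the real points, G takes the
    value D h up to smaller terms when its argument is moved by h = +s^M or h =
    -s^M away from the truncation of [beta]; hence G changes sign in between. *)
Lemma root_near (e : R -> {rmorphism A -> R}) (G : {poly A}) N k :
  let M := (N + k).+1 in let N' := (M + k).+1 in
  (forall w, approx q N' (e ^~ w) (ev w)) -> ev_ext G = 0 ->
  scoef q (ev_ext G^`()) k != 0 ->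
  (forall j, (j < k)%N -> scoef q (ev_ext G^`()) j = 0) ->
  exists2 y, approx q N y beta &
    \forall s \near (0 : R)^'+, (map_poly (e s) G).[y s] = 0.
Proof.
move=> M N' eN' G0 Dk Dj.
pose y0 s := (trunc q N' beta).[s].
have y0N : approx q N' y0 beta by exact: approx_trunc.
have y0b := approx_bounded y0N.
have eb w : bigO 0 (e ^~ w) := approx_bounded (eN' w).
have gy0 : bigO N' (fun s => (map_poly (e s) G).[y0 s]).
  by apply: approx0_bigO; rewrite -G0; exact: approx_ext.
(* D has valuation k, so D h has order M + k; the order N' = M + k + 1 of the
   approximation makes the value of G at y0 negligible, and M > k does the same
   for the quadratic term. *)
pose D s := (map_poly (e s) G^`()).[y0 s].
pose d := scoef q (ev_ext G^`()) k.
have DO : bigO k.+1 (fun s => D s - d * s ^+ k).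
  apply: (@approx_lead _ _ N'); [exact: approx_ext| |exact: Dj].
  by rewrite /N' ltnS leq_addl.
have near_sign (b : bool) : \forall s \near (0 : R)^'+,
    `|(map_poly (e s) G).[y0 s + (-1) ^+ b * s ^+ M] - (-1) ^+ b * d * s ^+ (M + k)|
      <= `|d| / 2 * s ^+ (M + k).
  pose h s : R := (-1) ^+ b * s ^+ M.
  have hM : bigO M h := bigOM (bigO_cst ((-1) ^+ b)) (bigOX R M).
  have h0 := bigO_le (leq0n _) hM.
  have [r r0 rE] := taylor2_bigO eb G y0b h0.
  apply: bigO_small; first by rewrite divr_gt0 ?normr_gt0.
  have h2 : bigO N' (fun s => h s ^+ 2 * r s).
    have : bigO (M + M + 0) (fun s => h s * h s * r s).
      by apply: bigOM => //; exact: bigOM.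
    rewrite addn0; apply: bigO_le; rewrite /N' -addnS leq_add2l /M.
    by rewrite ltnS leq_addl.
  have hD : bigO N' (fun s => h s * (D s - d * s ^+ k)).
    by rewrite /N' -addnS; exact: bigOM.
  apply: bigO_eq (bigOD (bigOD gy0 hD) h2); near=> s.
  by rewrite rE /D /h exprD; ring.
pose root_at s y := `|y - y0 s| <= s ^+ M /\ (map_poly (e s) G).[y] = 0.
have ex_root : \forall s \near (0 : R)^'+, exists y, root_at s y.
  apply: filterS3 (near0_gt0 R) (near_sign false) (near_sign true) => s s0.
  have sM : 0 < s ^+ M by exact: exprn_gt0.
  have sMk : 0 < s ^+ (M + k) by exact: exprn_gt0.
  rewrite expr0 expr1 !mul1r !mulN1r => hp hm.
  pose p := map_poly (e s) G.
  have prod : p.[y0 s - s ^+ M] * p.[y0 s + s ^+ M] <= 0.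
    move: hp hm; rewrite -/p !ler_norml => /andP[a1 a2] /andP[b1 b2].
    have [dp|dn] := leP 0 d.
      move: a1 a2 b1 b2; rewrite ger0_norm// => a1 a2 b1 b2.
      have ds : 0 <= d * s ^+ (M + k) by rewrite mulr_ge0// ltW.
      by apply: mulr_le0_ge0; lra.
    move: a1 a2 b1 b2; rewrite ltr0_norm// => a1 a2 b1 b2.
    have ds : d * s ^+ (M + k) <= 0 by rewrite mulr_le0_ge0// ltW.
    by apply: mulr_ge0_le0; lra.
  have ab : y0 s - s ^+ M <= y0 s + s ^+ M by lra.
  have [y + /eqP py] := polyrcf.poly_ivt ab prod.
  rewrite in_itv/= => /andP[y1 y2].
  by exists y; split => //; rewrite ler_norml; apply/andP; split; lra.
pose y s := xget (y0 s) [set y | root_at s y].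
exists y; last first.
  apply: filterS ex_root => s [y1 sy1].
  by rewrite /y; case: xgetP => [? _ []//|/(_ y1)].
have yy0 : bigO N' (fun s => y0 s - (trunc q N' beta).[s]) by exact: y0N.
have yM : bigO M (fun s => y s - y0 s).
  exists 1; near=> s; rewrite mul1r /y; case: xgetP => [? _ []//|_].
  have s0 : 0 < s by near: s; exact: near0_gt0.
  by rewrite subrr normr0 exprn_ge0// ltW.
apply: (@approx_le _ _ M); first by rewrite /M ltnW// ltnS leq_addr.
have y0M : approx q M y0 beta.
  by apply: approx_le y0N; rewrite /N' ltnW// ltnS leq_addr.
apply: bigO_eq (bigOD yM y0M); near=> s; ring.
Unshelve. all: by end_near. Qed.

(** Minimality of G makes the pseudo-remainder of any relation by G vanish
    identically under [ev]. It is therefore enough to keep the coefficients of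
    these remainders equal to zero and to take for the new coordinate a real
    root of G close to [beta]. *)
Lemma algebraic_step P : ev_ext P = 0 -> map_poly ev P != 0 ->
  realizable c ev -> realizable (fun x => (c x)%:P) ev_ext.
Proof.
move=> P0 evP IH Z N evZ.
have [G [G0 sG Gn0 Gmin]] := minimal_relation P0 evP.
have evG : map_poly ev G != 0 by rewrite -size_poly_gt0 sG size_poly_gt0.
have D0 : ev_ext G^`() != 0.
  apply/eqP => /Gmin; rewrite lt_size_deriv// => /(_ isT)/eqP.
  rewrite -deriv_map; apply/negP.
  have sG1 : (1 < size (map_poly ev G))%N.
    rewrite ltnNge; apply/negP => /size1_polyC GC.
    move/eqP: G0; rewrite /= /horner_eval GC hornerC => /eqP g0.
    by move/eqP: evG; apply; rewrite GC g0.
  apply/eqP => /(congr1 (fun p : {poly F} => p`_(size (map_poly ev G)).-2)).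
  rewrite coef0 coef_deriv => /eqP; rewrite mulrn_eq0 /=.
  case nE: (size (map_poly ev G)) sG1 => [|[|n]]// _.
  by move: evG; rewrite -lead_coef_eq0 /lead_coef nE /= => /negPf ->.
have [k Dk Dj] := series_lead q_gt0 (@ev_ext_series _) D0.
have lc0 : ev (lead_coef G) != 0.
  by move: evG; rewrite -lead_coef_eq0 /lead_coef sG coef_map.
have [k2 lk lj] := series_lead q_gt0 (@ev_series _) lc0.
pose rem (H : {poly A}) := Pdiv.Idomain.modp H G.
have remE H : (lead_coef G ^+ Pdiv.Idomain.scalp H G) *: H =
  (Pdiv.Idomain.divp H G) * G + rem H by exact: Pdiv.Idomain.divp_eq.
have rem0 H : H \in [seq rem H | H <- Z] -> map_poly ev H = 0.
  move=> /mapP[K KZ ->]; apply: Gmin; last exact: Pdiv.Idomain.ltn_modpN0.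
  have -> : rem K = (lead_coef G ^+ Pdiv.Idomain.scalp K G)%:P * K
      - (Pdiv.Idomain.divp K G) * G.
    by rewrite mul_polyC remE addrC addKr.
  rewrite rmorphB !rmorphM; have := evZ _ KZ => /= ->.
  by move: G0 => /= ->; rewrite !mulr0 subr0.
(* The order exceeds the valuation k2 of the leading coefficient of G, so that
   this coefficient does not vanish at the real points. *)
pose M := (N + k2 + k).+1.
have [e [ec eN eZ]] := IH (coefs [seq rem H | H <- Z]) (M + k).+1 (coefs_ker rem0).
have [y yN yG] := root_near eN G0 Dk Dj.
exists (ext e y); split.
- by move=> s x /=; rewrite /horner_eval/= map_polyC hornerC; exact: ec.
- move=> H; apply: approx_ext.
    by move=> w; apply: approx_le (eN w); rewrite /M; lia.
  by apply: approx_le yN; rewrite leq_addr.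
- move=> H HZ.
  have eR := coefs0 eZ (map_f rem HZ).
  have elc : \forall s \near (0 : R)^'+, e s (lead_coef G) != 0.
    have k2M : (k2 < (M + k).+1)%N by rewrite /M; lia.
    apply: filterS2 (near0_gt0 R) (approx_neq0 (eN _) k2M lj lk) => s s0.
    rewrite -normr_gt0; apply: lt_le_trans.
    by rewrite mulr_gt0 ?exprn_gt0// divr_gt0 ?normr_gt0.
  apply: filterS3 eR elc yG => s eR0 el0 yG0 /=.
  have /(congr1 (fun p => (map_poly (e s) p).[y s])) := remE H.
  rewrite -mul_polyC rmorphD !rmorphM/= map_polyC hornerD !hornerM yG0 eR0.
  rewrite hornerC horner0 mulr0 addr0 => /eqP.
  have eX n : e s (lead_coef G ^+ n) = e s (lead_coef G) ^+ n by exact: rmorphXn.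
  rewrite mulf_eq0 => /orP[/eqP h0|/eqP//].
  have /eqP := etrans (esym (eX _)) h0; rewrite expf_eq0 => /andP[_].
  by rewrite (negPf el0).
Qed.

Lemma realizable_step :
  realizable c ev -> realizable (fun x => (c x)%:P) ev_ext.
Proof.
have [[P [P0 evP]]|gen] := pselect (exists P, ev_ext P = 0 /\ map_poly ev P != 0).
  exact: algebraic_step P0 evP.
apply: generic_step => P P0; apply/eqP/negPn/negP => evP.
by apply: gen; exists P.
Qed.

End Step.
End Families.

(** * Properties holding along every good approximation *)

Section ConstantSeries.
Variable R : realType.

Fact pconst_zmod_morphism : zmod_morphism (@pconst R).
Proof.
move=> x y; apply: puiseux_eq => r /=.
by case: ifP => //; rewrite subr0.
Qed.

Fact pconst_monoid_morphism : monoid_morphism (@pconst R).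
Proof.
split=> [//|x y]; rewrite (mul_pseq (q := 1) isT); try exact: power_series_cst.
rewrite (pconst_pseq (q := 1) isT); congr pseq; apply/funext => k.
rewrite /Defs.cauchy big_ord_recl !scoef_cst// subn0 big1 ?addr0.
  by case: eqP; rewrite ?mulr0.
by move=> i _; rewrite scoef_cst//= mul0r.
Qed.

HB.instance Definition _ :=
  GRing.isZmodMorphism.Build R (puiseux R) (@pconst R) pconst_zmod_morphism.
HB.instance Definition _ :=
  GRing.isMonoidMorphism.Build R (puiseux R) (@pconst R) pconst_monoid_morphism.

End ConstantSeries.

Section Realization.
Variables (R : realType) (q : nat) (q_gt0 : (0 < q)%N).
Local Notation F := (puiseux R).

(** The tower of polynomial rings is built one series at a time. The head of the
    sequence is the last series adjoined, hence the outermost indeterminate. *)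
Lemma realizable_seq (b : seq F) : (forall i, power_series q b`_i) ->
  exists (A : idomainType) (c : R -> A) (ev : {rmorphism A -> F}) (X : nat -> A),
  [/\ forall w, power_series q (ev w), realizable q c ev,
      forall x, ev (c x) = pconst x, forall i, ev (X i) = b`_i
    & forall i, (size b <= i)%N -> X i = 0].
Proof.
elim: b => [_|beta b IH bS].
  exists R, id, (@pconst R), (fun=> 0); split=> //.
  - by move=> w; exact: power_series_cst.
  - move=> Z N Z0; exists (fun s => idfun); split=> //.
      by move=> w; exact: approx_cst.
    move=> z /Z0 /(congr1 (fun f : F => f 0)) /= ->.
    by near=> s.
  - by move=> i; rewrite nth_nil; exact: rmorph0.
have [A [c [ev [X [evS evR evc evX X0]]]]] := IH (fun i => bS i.+1).
have betaS := bS 0%N.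
exists {poly A}, (fun x => (c x)%:P), (ev_ext ev beta).
exists (fun i => if i is j.+1 then (X j)%:P else 'X); split.
- by move=> w; exact: ev_ext_series.
- exact: realizable_step.
- by move=> x; rewrite /= /horner_eval map_polyC hornerC; exact: evc.
- move=> [|i]; rewrite /= /horner_eval ?map_polyX ?hornerX//.
  by rewrite map_polyC hornerC; exact: evX.
- by move=> [//|i] ib; rewrite X0.
Unshelve. all: by end_near. Qed.

Section Terms.
Variables (A : nzRingType) (c : R -> A) (X : nat -> A).

Fixpoint tval (t : qe_rcf.term R) : A :=
  match t with
  | qe_rcf.Var i => X i
  | qe_rcf.Const x => c x
  | qe_rcf.NatConst k => k%:R
  | qe_rcf.Add u v => tval u + tval v
  | qe_rcf.Opp u => - tval u
  | qe_rcf.NatMul u k => tval u *+ k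
  | qe_rcf.Mul u v => tval u * tval v
  | qe_rcf.Exp u k => tval u ^+ k
  end.

Lemma tvalE (K : realDomainType) (h : R -> K) (f : {rmorphism A -> K}) e t :
  (forall x, f (c x) = h x) -> (forall i, f (X i) = e`_i) ->
  f (tval t) = qe_rcf.eval e (map_term h t).
Proof.
move=> fc fX; elim: t => //=.
- by move=> k; exact: rmorph_nat.
- by move=> u <- v <-; exact: rmorphD.
- by move=> u <-; exact: rmorphN.
- by move=> u <- k; exact: rmorphMn.
- by move=> u <- v <-; exact: rmorphM.
- by move=> u <- k; exact: rmorphXn.
Qed.

End Terms.

Lemma map_term_id (t : qe_rcf.term R) : map_term id t = t.
Proof. by elim: t => //= [u -> v ->|u ->|u ->|u -> v ->|u ->]. Qed.

Section Along.
Variables (A : idomainType) (c : R -> A) (ev : {rmorphism A -> F}).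
Hypotheses (evS : forall w, power_series q (ev w)) (evR : realizable q c ev)
  (evc : forall x, ev (c x) = pconst x).

(** A filter of properties: [V] holds at all points of every family, for s
    small, as soon as enough relations and a sufficient order of approximation
    are imposed on the family. This dispenses with tracking these two data. *)
Definition along (V : {rmorphism A -> R} -> R -> Prop) :=
  exists (Z : seq A) N, (forall z, z \in Z -> ev z = 0) /\
  forall e, family q c ev Z N e -> \forall s \near (0 : R)^'+, V (e s) s.

Implicit Types V W : {rmorphism A -> R} -> R -> Prop.

(** This is where realizability enters: properties holding along families hold
    at actual real points. *)
Lemma along_ex V : along V -> \forall s \near (0 : R)^'+, exists e, V e s.
Proof.
move=> [Z [N [Z0 VP]]]; have [e /VP] := evR N Z0.
by apply: filterS => s Vs; exists (e s).
Qed.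

Lemma along_near (P : R -> Prop) :
  (\forall s \near (0 : R)^'+, P s) -> along (fun _ s => P s).
Proof. by move=> nP; exists [::], 0%N; split=> // e _. Qed.

Lemma alongS V W : (forall e s, V e s -> W e s) -> along V -> along W.
Proof.
move=> VW [Z [N [Z0 VP]]]; exists Z, N; split=> // e /VP.
by apply: filterS => s; exact: VW.
Qed.

Lemma along_and V W : along V -> along W -> along (fun e s => V e s /\ W e s).
Proof.
move=> [Z1 [N1 [Z10 V1]]] [Z2 [N2 [Z20 V2]]].
exists (Z1 ++ Z2), (maxn N1 N2); split.
  by move=> z; rewrite mem_cat => /orP[/Z10|/Z20].
move=> e [ec eN eZ]; near=> s; split; near: s.
- apply: V1; split=> // [w|z zZ].
    by apply: approx_le (eN w); rewrite leq_maxl.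
  by apply: eZ; rewrite mem_cat zZ.
- apply: V2; split=> // [w|z zZ].
    by apply: approx_le (eN w); rewrite leq_maxr.
  by apply: eZ; rewrite mem_cat zZ orbT.
Unshelve. all: by end_near. Qed.

Lemma alongS2 V W U : (forall e s, V e s -> W e s -> U e s) ->
  along V -> along W -> along U.
Proof.
by move=> VWU aV aW; apply: alongS (along_and aV aW) => e s [] /VWU.
Qed.

Lemma along_cst : along (fun e _ => forall x, e (c x) = x).
Proof.
by exists [::], 0%N; split=> // e [ec _ _]; near=> s => x; exact: ec.
Unshelve. all: by end_near. Qed.

Lemma along_eq0 w : ev w = 0 -> along (fun e _ => e w = 0).
Proof.
move=> w0; exists [:: w], 0%N; split=> [z|e [_ _]].
  by rewrite inE => /eqP ->.
by apply; rewrite mem_head.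
Qed.

Lemma along_approx w N :
  along (fun e s => `|e w - (trunc q N.+1 (ev w)).[s]| <= s ^+ N).
Proof.
exists [::], N.+1; split=> // e [_ eN _].
have := bigO_small ltr01 (eN w); apply: filterS => s.
by rewrite mul1r.
Qed.

Lemma along_bounded w : exists C, along (fun e _ => `|e w| <= C).
Proof.
exists (1 + `|scoef q (ev w) 0|); apply: alongS (along_approx w 0) => e s.
have -> : trunc q 1 (ev w) = (scoef q (ev w) 0)%:P.
  by apply/polyP => -[|i]; rewrite coef_poly coefC.
rewrite hornerC expr0 => h; rewrite -[e w](subrK (scoef q (ev w) 0)).
by rewrite (le_trans (ler_normD _ _))// lerD2r.
Qed.

(** The valuation [k] bounds the order of approximation that has to be imposed. *)
Lemma along_lead w k : (forall j, (j < k)%N -> scoef q (ev w) j = 0) ->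
  scoef q (ev w) k != 0 ->
  along (fun e s => Num.sg (e w) = Num.sg (scoef q (ev w) k) /\
    `|scoef q (ev w) k| / 2 * s ^+ k <= `|e w|).
Proof.
set d := scoef q (ev w) k => w0 d0.
have : along (fun e s => 0 < s /\ `|e w - d * s ^+ k| <= `|d| / 2 * s ^+ k).
  exists [::], k.+1; split=> // e [_ eN _].
  have d2 : 0 < `|d| / 2 by rewrite divr_gt0 ?normr_gt0.
  have dO := approx_lead (eN w) (ltnSn k) w0.
  by apply: filterS2 (near0_gt0 R) (bigO_small d2 dO) => s.
apply: alongS => e s [s0]; have sk : 0 < s ^+ k by exact: exprn_gt0.
rewrite ler_norml => /andP[h1 h2].
move: d0; rewrite neq_lt => /orP[dn|dp].
- move: h1 h2; rewrite ltr0_norm// => h1 h2.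
  have dsk : d * s ^+ k < 0 by rewrite nmulr_rlt0.
  have ew : e w < 0 by lra.
  by rewrite !ltr0_sg// ltr0_norm//; split=> //; lra.
- move: h1 h2; rewrite gtr0_norm// => h1 h2.
  have dsk : 0 < d * s ^+ k by rewrite mulr_gt0.
  have ew : 0 < e w by lra.
  by rewrite !gtr0_sg// gtr0_norm//; split=> //; lra.
Qed.

Lemma along_gt0 w : 0 < ev w -> along (fun e _ => 0 < e w).
Proof.
move=> /(pos_lead q_gt0 (@evS w))[k k0 kmin].
apply: alongS (along_lead kmin (lt0r_neq0 k0)) => e s [+ _].
by rewrite (gtr0_sg k0) => /eqP; rewrite sgr_cp0.
Qed.

Lemma along_lt0 w : ev w < 0 -> along (fun e _ => e w < 0).
Proof.
move=> w0; have : along (fun e _ => 0 < e (- w)).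
  by apply: along_gt0; rewrite rmorphN oppr_gt0.
by apply: alongS => e s; rewrite rmorphN oppr_gt0.
Qed.

Section Points.
Variables (b : seq F) (X : nat -> A).
Hypotheses (evX : forall i, ev (X i) = b`_i)
  (X0 : forall i, (size b <= i)%N -> X i = 0).

Definition point (e : {rmorphism A -> R}) : seq R :=
  mkseq (fun i => e (X i)) (size b).

Lemma nth_point e i : (point e)`_i = e (X i).
Proof.
have [ib|ib] := ltnP i (size b); first by rewrite nth_mkseq.
by rewrite nth_default ?size_mkseq// X0//; apply/esym; exact: rmorph0.
Qed.

Lemma along_term t : along (fun e _ => e (tval c X t) = qe_rcf.eval (point e) t).
Proof.
apply: alongS along_cst => e _ ec; rewrite -[t in RHS]map_term_id.
by apply: tvalE => // i; rewrite nth_point.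
Qed.

(** Every atom compares an element of [A] with 0. If its image under [ev] is
    zero, this is imposed as a relation; otherwise its sign is that of its
    leading coefficient, which is visible at a finite order of approximation. *)
Lemma along_eval phi : along (fun e _ => qe_rcf.qf_eval (point e) phi =
  qe_rcf.qf_eval b (map_formula (@pconst R) phi)).
Proof.
have evt t : ev (tval c X t) = qe_rcf.eval b (map_term (@pconst R) t).
  exact: tvalE.
have sgt u v : along (fun e _ =>
    ((qe_rcf.eval (point e) u == qe_rcf.eval (point e) v) =
      (qe_rcf.eval b (map_term (@pconst R) u) ==
       qe_rcf.eval b (map_term (@pconst R) v))) /\
    ((qe_rcf.eval (point e) u < qe_rcf.eval (point e) v) =
      (qe_rcf.eval b (map_term (@pconst R) u) <
       qe_rcf.eval b (map_term (@pconst R) v)))).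
  rewrite -!evt; pose w := tval c X v - tval c X u.
  have wE : ev w = ev (tval c X v) - ev (tval c X u) by exact: rmorphB.
  have := along_and (along_term u) (along_term v).
  have [uv|vu|uv] := ltgtP (ev (tval c X u)) (ev (tval c X v)).
  - have w0 : 0 < ev w by rewrite wE subr_gt0.
    apply: alongS2 (along_gt0 w0) => e s + [<- <-].
    by rewrite rmorphB subr_gt0 => h; rewrite h lt_eqF.
  - have w0 : ev w < 0 by rewrite wE subr_lt0.
    apply: alongS2 (along_lt0 w0) => e s + [<- <-].
    by rewrite rmorphB subr_lt0 => h; rewrite gt_eqF// ltNge ltW.
  - have w0 : ev w = 0 by rewrite wE uv subrr.
    apply: alongS2 (along_eq0 w0) => e s + [<- <-].
    by rewrite rmorphB => /eqP; rewrite subr_eq0 => /eqP ->; rewrite eqxx ltxx.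
elim: phi => /=.
- by move=> B; apply: alongS along_cst.
- by move=> u v; apply: alongS (sgt u v) => e s [].
- by move=> u v; apply: alongS (sgt u v) => e s [].
- by move=> u v; apply: alongS (sgt u v) => e s [h1 h2]; rewrite !le_eqVlt h1 h2.
- by move=> p IHp p' IHp'; apply: alongS2 IHp IHp' => e s -> ->.
- by move=> p IHp p' IHp'; apply: alongS2 IHp IHp' => e s -> ->.
- by move=> p IHp p' IHp'; apply: alongS2 IHp IHp' => e s -> ->.
- by move=> p IHp; apply: alongS IHp => e s ->.
Qed.

Lemma map_horner_MXaddC (e : {rmorphism A -> R}) (P : {poly A}) x d :
  (map_poly e (P * 'X + x%:P)).[d] = (map_poly e P).[d] * d + e x.
Proof. by rewrite rmorphD rmorphM/= map_polyX map_polyC hornerMXaddC. Qed.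

Lemma along_map_bounded (P : {poly A}) : exists C, along (fun e _ =>
  forall d, 0 < d <= 1 -> `|(map_poly e P).[d]| <= C).
Proof.
elim/poly_ind: P => [|P x [C PC]].
  exists 0; apply: alongS along_cst => e s _ d _.
  by rewrite rmorph0 horner0 normr0.
have [D xD] := along_bounded x; exists (C + D).
apply: alongS2 PC xD => e s PC xD d /andP[d0 d1].
rewrite map_horner_MXaddC.
rewrite (le_trans (ler_normD _ _))// lerD// normrM.
have Pd : `|(map_poly e P).[d]| <= C by apply: PC; rewrite d0.
by rewrite -[C]mulr1 ler_pM// gtr0_norm.
Qed.

Lemma sgrD_dominated (u v : R) : `|u| < `|v| -> Num.sg (u + v) = Num.sg v.
Proof.
have [v0|v0|->] := ltgtP v 0; last by rewrite normr0 ltNge normr_ge0.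
- rewrite (ltr0_norm v0) => /ltr_normlP[? ?]; rewrite !ltr0_sg//; lra.
- rewrite (gtr0_norm v0) => /ltr_normlP[? ?]; rewrite !gtr0_sg//; lra.
Qed.

(** In increasing degree, the coefficients that vanish under [ev] vanish at the
    real points too, and the first one that does not, of valuation k, is at
    least a multiple of s^k; it dominates the higher terms, which are bounded by
    a multiple of s^(k+1), as soon as the argument is at most s^(k+1). *)
Lemma along_tail_sgr (P : {poly A}) : exists (K : nat) (sg : R), along (fun e s =>
  forall d, 0 < d <= s ^+ K -> Num.sg (map_poly e P).[d] = sg).
Proof.
elim/poly_ind: P => [|P x [K [sg PK]]].
  exists 0%N, 0; apply: alongS along_cst => e s _ d _.
  by rewrite rmorph0 horner0 sgr0.
have [x0|x0] := eqVneq (ev x) 0.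
  exists K, sg; apply: alongS2 PK (along_eq0 x0) => e s PK ex d dK.
  rewrite map_horner_MXaddC ex addr0 sgrM PK//.
  by have /andP[d0 _] := dK; rewrite gtr0_sg// mulr1.
have [k k0 kmin] := series_lead q_gt0 (@evS x) x0.
have [C PC] := along_map_bounded P.
exists k.+1, (Num.sg (scoef q (ev x) k)).
pose m := `|scoef q (ev x) k| / 2.
have m0 : 0 < m by rewrite divr_gt0 ?normr_gt0.
have small : \forall s \near (0 : R)^'+, 0 < s < 1 /\ s < m / (`|C| + 1).
  near=> s; split; first by apply/andP; split; near: s; [exact: near0_gt0|exact: near0_lt].
  by near: s; apply: near0_lt; rewrite divr_gt0// ltr_wpDl.
have := along_and (along_near small) (along_lead kmin k0).
apply: alongS2 PC => e s PC [[/andP[s0 s1] sm] [<- xlow]] d /andP[d0 dk].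
have d1 : d <= 1 by rewrite (le_trans dk)// exprn_ile1// ltW.
rewrite map_horner_MXaddC.
apply: sgrD_dominated; apply: lt_le_trans xlow.
have Pd : `|(map_poly e P).[d]| <= C by apply: PC; rewrite d0.
have C0 : 0 <= C by exact: le_trans Pd.
rewrite normrM (gtr0_norm d0).
apply: (@le_lt_trans _ _ (C * s ^+ k.+1)).
  by apply: ler_pM => //; exact: ltW.
rewrite exprS mulrA ltr_pM2r ?exprn_gt0//.
move: sm; rewrite ltr_pdivlMr ?ltr_wpDl// ger0_norm//; apply: le_lt_trans.
by rewrite mulrC ler_pM2l// lerDl.
Unshelve. all: by end_near. Qed.

(** A uniform version of the eventual constancy of signs of polynomials in one
    variable: the threshold below which the truth value is constant can be taken
    to be a power of s. The extra variable has index 0. *)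
Lemma along_tail phi : exists (K : nat) (B : bool), along (fun e s =>
  forall d, 0 < d <= s ^+ K -> qe_rcf.qf_eval (d :: point e) phi = B).
Proof.
pose c' x := (c x)%:P; pose X' i := if i is j.+1 then (X j)%:P else 'X.
have termE t : along (fun e s => forall d,
    qe_rcf.eval (d :: point e) t = (map_poly e (tval c' X' t)).[d]).
  apply: alongS along_cst => e s ec d.
  rewrite -[t in LHS]map_term_id; apply/esym.
  apply: (tvalE (f := horner_eval d \o map_poly e)) => [x|[|i]] /=.
  - by rewrite /horner_eval map_polyC hornerC; exact: ec.
  - by rewrite /horner_eval map_polyX hornerX.
  - by rewrite /horner_eval map_polyC hornerC nth_point.
have sgt u v : exists (K : nat) (b1 b2 : bool), along (fun e s =>
    forall d, 0 < d <= s ^+ K ->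
    (qe_rcf.eval (d :: point e) u == qe_rcf.eval (d :: point e) v) = b1 /\
    (qe_rcf.eval (d :: point e) u < qe_rcf.eval (d :: point e) v) = b2).
  have [K [sg sgP]] := along_tail_sgr (tval c' X' v - tval c' X' u).
  exists K, (sg == 0), (sg == 1).
  have := along_and (termE u) (termE v).
  apply: alongS2 sgP => e s sgP [uE vE] d dK; rewrite uE vE -(sgP d dK).
  rewrite rmorphB hornerD hornerN sgr_eq0 subr_eq0 eq_sym; split=> //.
  by rewrite sgr_cp0 subr_gt0.
have mono K K2 (s d : R) : (K <= K2)%N -> 0 < s < 1 -> 0 < d <= s ^+ K2 -> 0 < d <= s ^+ K.
  move=> KK /andP[s0 s1] /andP[-> /le_trans->//].
  by rewrite ler_wiXn2l// ltW.
have s01 : along (fun _ s => 0 < s < 1).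
  apply: along_near; near=> s.
  by apply/andP; split; near: s; [exact: near0_gt0|exact: near0_lt].
have bin (op : bool -> bool -> bool) p p' :
    (exists (K : nat) (B : bool), along (fun e s =>
      forall d, 0 < d <= s ^+ K -> qe_rcf.qf_eval (d :: point e) p = B)) ->
    (exists (K : nat) (B : bool), along (fun e s =>
      forall d, 0 < d <= s ^+ K -> qe_rcf.qf_eval (d :: point e) p' = B)) ->
    exists (K : nat) (B : bool), along (fun e s => forall d, 0 < d <= s ^+ K ->
      op (qe_rcf.qf_eval (d :: point e) p) (qe_rcf.qf_eval (d :: point e) p') = B).
  move=> [K [B pB]] [K' [B' pB']]; exists (maxn K K'), (op B B').
  apply: alongS2 (along_and pB pB') s01 => e s [h h'] s1 d dK.
  rewrite (h _ (mono _ _ _ _ (leq_maxl K K') s1 dK)).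
  by rewrite (h' _ (mono _ _ _ _ (leq_maxr K K') s1 dK)).
elim: phi => /=.
- by move=> B; exists 0%N, B; apply: alongS along_cst.
- move=> u v; have [K [b1 [b2 h]]] := sgt u v.
  by exists K, b1; apply: alongS h => e s h d /h[].
- move=> u v; have [K [b1 [b2 h]]] := sgt u v.
  by exists K, b2; apply: alongS h => e s h d /h[].
- move=> u v; have [K [b1 [b2 h]]] := sgt u v.
  exists K, (b1 || b2); apply: alongS h => e s h d /h[h1 h2].
  by rewrite le_eqVlt h1 h2.
- by move=> p IHp p' IHp'; exact: (bin andb).
- by move=> p IHp p' IHp'; exact: (bin orb).
- by move=> p IHp p' IHp'; exact: (bin implb).
- move=> p [K [B h]]; exists K, (~~ B); apply: alongS h => e s h d /h.
  by move=> ->.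
Unshelve. all: by end_near. Qed.

End Points.
End Along.
End Realization.

(** * Realizing points of the extension of a semialgebraic set *)

Section RealizeVector.
Variables (R : realType) (q : nat) (q_gt0 : (0 < q)%N) (n : nat).

(** Artin-Lang theorem with approximation: a point of the extension of [S] is
    followed by real points of [S]. The second half replaces the transfer of
    statements about [D] to Puiseux series: at these points the truth of [D d y]
    for small [d] is decided once and for all, and already at d = s^K. *)
Lemma realize_vector (S : set 'rV[R]_n) (x : 'rV[puiseux R]_n)
    (D : R -> 'rV[R]_n -> Prop) :
  (forall i, power_series q (x ord0 i)) -> sa_ext S x ->
  definable (fun r => D (r 0%N) (\row_(i < n) r i.+1)) ->
  exists (K : nat) (B : bool), forall N, \forall s \near (0 : R)^'+,
  exists y, [/\ S y,
    forall i, `|y ord0 i - (trunc q N.+1 (x ord0 i)).[s]| <= s ^+ N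
    & forall d, 0 < d <= s ^+ K -> (D d y <-> B)].
Proof.
move=> xS [phi SE xphi] [psi psiP]; pose b := [tuple x ord0 i | i < n].
have bE (i : 'I_n) : (b : seq _)`_i = x ord0 i.
  by rewrite (nth_map i) ?size_enum_ord// nth_ord_enum.
have bS i : power_series q (b : seq _)`_i.
  have [ib|ib] := ltnP i n; first by rewrite (bE (Ordinal ib)).
  by rewrite nth_default ?size_tuple//; exact: power_series0.
have [A [c [ev [X [evS evR evc evX X0]]]]] := realizable_seq q_gt0 bS.
have [K [B tail]] := along_tail q_gt0 c evS X0 psi.
exists K, B => N.
have close : along q c ev (fun e s => forall i : 'I_n,
    `|e (X i) - (trunc q N.+1 (x ord0 i)).[s]| <= s ^+ N).
  have : along q c ev (fun e s => forall i, i \in enum 'I_n ->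
      `|e (X i) - (trunc q N.+1 (x ord0 i)).[s]| <= s ^+ N).
    elim: (enum _) => [|j l IH].
      by apply: alongS (along_cst q c ev).
    have := along_approx q c ev (X j) N; rewrite evX bE.
    apply: alongS2 IH => e s hl hj i; rewrite inE => /predU1P[->//|].
    exact: hl.
  by apply: alongS => e s h i; apply: h; rewrite mem_enum.
have good := along_and (along_and (along_eval q_gt0 evS evc evX X0 phi) close) tail.
apply: filterS (along_ex evR good) => s [e [[ephi eclose] etail]].
pose y : 'rV[R]_n := \row_i e (X i).
have yE : [tuple y ord0 i | i < n] = point b X e :> seq R.
  apply: (@eq_from_nth _ 0); first by rewrite size_mkseq !size_tuple.
  move=> i; rewrite size_tuple => ib.
  rewrite (nth_map (Ordinal ib)) ?size_enum_ord//.
  rewrite (nth_ord_enum _ (Ordinal ib)) mxE nth_mkseq ?size_tuple//.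
exists y; split.
- by rewrite SE /sat /mkset yE ephi; exact: xphi.
- by move=> i; rewrite mxE.
- move=> d dK; rewrite -(etail d dK) -yE; apply: iff_trans (psiP _).
  have {1}-> // : y = \row_(i < n) (d :: [tuple y ord0 i | i < n])`_i.+1.
  apply/rowP => i; rewrite [RHS]mxE /= (nth_map i) ?size_enum_ord//.
  by rewrite nth_ord_enum.
Qed.

End RealizeVector.

(** * Bounded continuous semialgebraic functions *)

Section Elementary.
Variables (R : realType) (m : nat) (M : set 'rV[R]_m).

Lemma continuous_epsdelta (f : M -> R) : continuous f <->
  forall (x : M) e, 0 < e -> exists2 d, 0 < d & forall y : M,
    `|set_val y - set_val x| < d -> `|f y - f x| < e.
Proof.
split=> [fc x e e0|fc x].
  have /cvgrPdist_lt/(_ _ e0) := fc x.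
  move=> /nbhs_ballP[d /= d0 dP]; exists d => // y yx.
  rewrite distrC; apply: dP; rewrite -initial_ballE /= mx_norm_ball /ball_/=.
  by rewrite distrC.
apply/(@cvgrPdist_lt _ _ _ (nbhs x) (nbhs_filter x)) => e e0.
have [d d0 dP] := fc x e e0.
apply/nbhs_ballP; exists d => //= y.
rewrite -initial_ballE /= mx_norm_ball /ball_/= => yx.
by rewrite distrC; apply: dP; rewrite distrC.
Qed.

Lemma bounded_funP (f : M -> R) : bounded_fun f <-> exists C, forall x, `|f x| <= C.
Proof.
split=> [[C [_ fC]]|[C fC]].
  by exists (C + 1) => x; apply: (fC (C + 1)) => //; rewrite ltrDl.
exists C; split; first exact: num_real.
by move=> D CD x _ /=; rewrite (le_trans (fC x))// ltW.
Qed.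

End Elementary.

Section GraphDefinability.
Variables (R : realType) (m : nat) (M : set 'rV[R]_m).
Implicit Types f g : M -> R.

(** The graph as a relation between vectors and reals; vectors outside the
    domain have no value, which is how the domain enters the formulas. *)
Definition takes_value f (x : 'rV[R]_m) (y : R) :=
  exists u : M, set_val u = x /\ f u = y.

Lemma fun_graphE f x y : fun_graph f (row_mx x y%:M) <-> takes_value f x y.
Proof.
split=> [[u _ /eq_row_mx[ux uy]]|[u [<- <-]]]; last by exists u.
exists u; split=> //; move/(congr1 (fun A : 'rV[R]_1 => A ord0 ord0)): uy.
by rewrite !mxE eqxx !mulr1n.
Qed.

Lemma definable_takes_value f (T : 'I_m -> (nat -> R) -> R) U :
  semialgebraic (fun_graph f) -> (forall i, polynomial_fun (T i)) ->
  polynomial_fun U -> definable (fun r => takes_value f (\row_i T i r) (U r)).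
Proof.
move=> fS TP UP; pose T' (i : 'I_(m + 1)) r :=
  match fintype.split i with inl j => T j r | inr _ => U r end.
have T'P i : polynomial_fun (T' i) by rewrite /T'; case: (fintype.split i).
apply: definable_ext (definable_sa fS T'P) => r.
rewrite -fun_graphE; suff -> : \row_i T' i r = row_mx (\row_i T i r) (U r)%:M by [].
apply/rowP => i; rewrite !mxE /T'; case: fintype.split => j; rewrite !mxE//.
by rewrite (ord1 j) eqxx mulr1n.
Qed.

Lemma sa_graph f (Q : 'rV[R]_m -> R -> Prop) :
  (forall x y, takes_value f x y <-> Q x y) ->
  definable (fun r => Q (\row_(i < m) r i) (r m)) -> semialgebraic (fun_graph f).
Proof.
move=> fQ dQ; apply: sa_definable dQ _ => r; rewrite -fQ -fun_graphE.
suff -> : \row_(i < m + 1) r i = row_mx (\row_(i < m) r i) (r m)%:M by [].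
apply/rowP => i; rewrite !mxE; case: splitP => j ij; rewrite !mxE ij//.
by rewrite (ord1 j) eqxx mulr1n addn0.
Qed.

Hypothesis Msa : semialgebraic M.

Lemma takes_value_fun f u : takes_value f (set_val u) (f u).
Proof. by exists u. Qed.

Lemma graph_cst c : semialgebraic (fun_graph ((fun=> c) : M -> R)).
Proof.
apply: (sa_graph (Q := fun x y => M x /\ y = c)).
  move=> x y; split=> [[u [<- <-]]|[Mx ->]]; first by split=> //; exact: set_valP.
  by exists (SigSub (mem_set Mx)).
apply: definable_and; last exact: definable_eq (polynomial_var _ _) (polynomial_cst _).
by apply: definable_sa => // i; exact: polynomial_var.
Qed.

Lemma graph_binop (op : R -> R -> R) f g :
  (forall S T : (nat -> R) -> R, polynomial_fun S -> polynomial_fun T ->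
    polynomial_fun (fun r => op (S r) (T r))) ->
  semialgebraic (fun_graph f) -> semialgebraic (fun_graph g) ->
  semialgebraic (fun_graph (fun x => op (f x) (g x))).
Proof.
move=> opP fS gS; apply: (sa_graph (Q := fun x y => exists z w,
    [/\ takes_value f x z, takes_value g x w & y = op z w])).
  move=> x y; split=> [[u [<- <-]]|[z [w [fz gw ->]]]].
    by exists (f u), (g u); split=> //; exact: takes_value_fun.
  case: fz gw => u [<- <-] [v [/val_inj -> <-]]; exact: takes_value_fun.
apply: definable_ex; apply: definable_ex.
apply: (@definable_ext _ (fun r => (takes_value f (\row_(i < m) r i.+2) (r 1%N) /\
  takes_value g (\row_(i < m) r i.+2) (r 0%N)) /\ r m.+2 = op (r 1%N) (r 0%N))).
  by move=> r; split=> [[[]]|[]].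
apply: definable_and; [apply: definable_and|].
- by apply: definable_takes_value => // [i|]; exact: polynomial_var.
- by apply: definable_takes_value => // [i|]; exact: polynomial_var.
- by apply: definable_eq; [|apply: opP]; exact: polynomial_var.
Qed.

Lemma graph_inv f : (forall x, f x != 0) -> semialgebraic (fun_graph f) ->
  semialgebraic (fun_graph (fun x => (f x)^-1)).
Proof.
move=> f0 fS; apply: (sa_graph (Q := fun x y => exists z,
    takes_value f x z /\ y * z = 1)).
  move=> x y; split=> [[u [<- <-]]|[_ [[u [<- <-]] yf]]].
    by exists (f u); split; [exact: takes_value_fun|rewrite mulVf].
  by exists u; split=> //; rewrite -[LHS]mul1r -yf mulfK.
apply: definable_ex; apply: definable_and.
- by apply: definable_takes_value => // [i|]; exact: polynomial_var.
- apply: definable_eq; last exact: polynomial_cst.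
  by apply: polynomialM; exact: polynomial_var.
Qed.

End GraphDefinability.

Section SstarRing.
Variables (R : realType) (m : nat) (M : set 'rV[R]_m) (Msa : semialgebraic M).
Implicit Types f g : M -> R.

Lemma Sstar_cst c : Sstar M (fun=> c).
Proof.
split; [exact: cst_continuous| |exact: graph_cst].
by apply/bounded_funP; exists `|c|.
Qed.

Lemma SstarD f g : Sstar M f -> Sstar M g -> Sstar M (f + g).
Proof.
move=> [fc /bounded_funP[C fC] fS] [gc /bounded_funP[D gD] gS]; split.
- by move=> x; apply: continuousD; [exact: fc|exact: gc].
- apply/bounded_funP; exists (C + D) => x.
  by rewrite (le_trans (ler_normD _ _))// lerD.
- by apply: (graph_binop (op := +%R)) => // S T; exact: polynomialD.
Qed.

Lemma SstarM f g : Sstar M f -> Sstar M g -> Sstar M (f * g).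
Proof.
move=> [fc /bounded_funP[C fC] fS] [gc /bounded_funP[D gD] gS]; split.
- by move=> x; apply: continuousM; [exact: fc|exact: gc].
- apply/bounded_funP; exists (C * D) => x.
  by rewrite normrM ler_pM.
- by apply: (graph_binop (op := *%R)) => // S T; exact: polynomialM.
Qed.

Lemma Sstar_inv f c : 0 < c -> (forall x, c <= f x) -> Sstar M f ->
  Sstar M (fun x => (f x)^-1).
Proof.
move=> c0 cf [fc /bounded_funP[C fC] fS].
have f0 x : 0 < f x by exact: lt_le_trans (cf x).
split.
- by move=> x; apply: continuousV; [rewrite gt_eqF|exact: fc].
- apply/bounded_funP; exists c^-1 => x.
  by rewrite normfV gtr0_norm// lef_pV2 ?posrE.
- by apply: graph_inv => // x; rewrite gt_eqF.
Qed.

End SstarRing.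

(** * Bump functions supported in a tube around an arc *)

Section Bump.
Variables (R : realType) (m : nat) (c : 'I_m -> {poly R}) (n : nat) (tau : R).
Hypotheses (n_gt0 : (0 < n)%N) (tau_gt0 : 0 < tau).
Implicit Types x y : 'rV[R]_m.

Definition curve t : 'rV[R]_m := \row_i (c i).[t].

Lemma norm_ltP x r : 0 < r -> `|x| < r <-> forall i, `|x ord0 i| < r.
Proof.
move=> r0; rewrite /Num.norm /= mx_normrE; split=> [/bigmax_ltP[_ h] i|h].
  exact: (h (ord0, i) isT).
by apply/bigmax_ltP; split=> // -[i j] _ /=; rewrite (ord1 i); exact: h.
Qed.

Lemma norm_leP (x : 'rV[R]_m) r : 0 <= r -> (forall i, `|x ord0 i| <= r) -> `|x| <= r.
Proof.
move=> r0 h; rewrite /Num.norm /= mx_normrE; apply/bigmax_leP; split=> // -[i j] _ /=.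
by rewrite (ord1 i).
Qed.

Definition tube t x : R := Num.max 0 (1 - `|x - curve t| / t ^+ n).

Definition bump x : R := sup [set tube t x | t in [set t | 0 < t <= tau]].

Lemma tube_ge0 t x : 0 <= tube t x.
Proof. by rewrite le_max lexx. Qed.

Lemma tube_le1 t x : 0 < t -> tube t x <= 1.
Proof.
move=> t0; rewrite ge_max ler01 /= gerBl divr_ge0//.
by rewrite exprn_ge0// ltW.
Qed.

Lemma tube_sup x : has_sup [set tube t x | t in [set t | 0 < t <= tau]].
Proof.
split; first by exists (tube tau x), tau => //=; rewrite tau_gt0 lexx.
by exists 1 => _ [t /= /andP[t0 _] <-]; exact: tube_le1.
Qed.

Lemma tube_le_bump t x : 0 < t <= tau -> tube t x <= bump x.
Proof. by move=> tt; apply: (sup_upper_bound (tube_sup x)); exists t. Qed.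

Lemma bump_leP x r : (forall t, 0 < t <= tau -> tube t x <= r) -> bump x <= r.
Proof.
move=> h; apply: ge_sup; first by have [] := tube_sup x.
by move=> _ [t tt <-]; exact: h.
Qed.

Lemma bump_ge0 x : 0 <= bump x.
Proof.
apply: le_trans (tube_ge0 tau x) (tube_le_bump x _).
by rewrite tau_gt0 lexx.
Qed.

Lemma bump_le1 x : bump x <= 1.
Proof. by apply: bump_leP => t /andP[t0 _]; exact: tube_le1. Qed.

Lemma lt_bumpP x r : r < bump x <-> exists2 t, 0 < t <= tau & r < tube t x.
Proof.
split=> [rb|[t tt rt]]; last exact: lt_le_trans (tube_le_bump x tt).
have e0 : 0 < bump x - r by rewrite subr_gt0.
have [_ [t tt <-] bt] := sup_adherent e0 (tube_sup x).
by exists t => //; move: bt; rewrite -/(bump x); lra.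
Qed.

Lemma lt_tubeP t x r : 0 < t ->
  r < tube t x <-> r < 0 \/ `|x - curve t| < (1 - r) * t ^+ n.
Proof.
move=> t0; have tn : 0 < t ^+ n by exact: exprn_gt0.
rewrite lt_max -ltr_pdivrMr//.
split=> [/orP[|h]|[->//|h]]; [by left|right; lra|apply/orP; right; lra].
Qed.

Lemma bump_neq0 x : bump x != 0 ->
  exists2 t, 0 < t <= tau & `|x - curve t| < t ^+ n.
Proof.
rewrite neq_lt ltNge bump_ge0 /= => /lt_bumpP[t tt].
have /andP[t0 _] := tt.
by move=> /(lt_tubeP _ _ t0)[|]; rewrite ?ltxx// subr0 mul1r => h; exists t.
Qed.

(** The condition r j < 1 expresses that the radius is positive, which the
    conditions on the coordinates do not imply when there are none. *)
Lemma definable_lt_bump j k :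
  definable (fun r => r j < bump (\row_(i < m) r (k + i)%N)).
Proof.
apply: (@definable_ext _ (fun r => exists t, (0 < t /\ t <= tau) /\
    (r j < 0 \/ (r j < 1 /\ forall i : 'I_m,
      - ((1 - r j) * t ^+ n) < r (k + i)%N - (c i).[t] /\
      r (k + i)%N - (c i).[t] < (1 - r j) * t ^+ n)))).
  move=> r; rewrite lt_bumpP; split.
    move=> [t [[t0 tt] h]]; exists t; first by rewrite t0.
    apply/(lt_tubeP _ _ t0); case: h => [|[rj h]]; [by left|right].
    apply/norm_ltP; first by rewrite mulr_gt0 ?exprn_gt0// subr_gt0.
    by move=> i; rewrite !mxE ltr_norml; apply/andP; exact: h.
  move=> [t /andP[t0 tt] /(lt_tubeP _ _ t0) h]; exists t; split=> //.
  case: h => [|h]; [by left|right].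
  have r0 : 0 < (1 - r j) * t ^+ n by exact: le_lt_trans h.
  split; first by move: r0; rewrite pmulr_lgt0 ?exprn_gt0// subr_gt0.
  move: h => /norm_ltP - /(_ r0) h i.
  by have := h i; rewrite !mxE ltr_norml => /andP.
apply: definable_ex; apply: definable_and.
  apply: definable_and; [apply: definable_lt|apply: definable_le];
    by [exact: polynomial_var|exact: polynomial_cst].
have pV : polynomial_fun (fun r : nat -> R => (1 - r j.+1) * r 0%N ^+ n).
  apply: polynomialM; last by apply: polynomialX; exact: polynomial_var.
  apply: polynomialD; first exact: polynomial_cst.
  by apply: polynomialN; exact: polynomial_var.
have pD (i : 'I_m) :
    polynomial_fun (fun r : nat -> R => r (k + i).+1 - (c i).[r 0%N]).
  apply: polynomialD; first exact: polynomial_var.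
  by apply: polynomialN; apply: polynomial_horner; exact: polynomial_var.
apply: definable_or; last apply: definable_and.
- by apply: definable_lt; [exact: polynomial_var|exact: polynomial_cst].
- by apply: definable_lt; [exact: polynomial_var|exact: polynomial_cst].
apply: definable_forall_fin => i; apply: definable_and.
- by apply: definable_lt; [exact: polynomialN|exact: pD].
- by apply: definable_lt; [exact: pD|exact: pV].
Qed.

(** Parameters below [t0] contribute nothing at a point that stays at distance
    t^n from the arc, and the other ones give functions that are Lipschitz with
    the same constant. *)
Lemma bump_lipschitz t0 x y : 0 < t0 ->
  (forall t, 0 < t < t0 -> t ^+ n <= `|y - curve t|) ->
  bump y <= bump x + `|y - x| / t0 ^+ n.
Proof.
move=> t00 far; have t0n : 0 < t0 ^+ n by exact: exprn_gt0.
apply: bump_leP => t /andP[tp tt]; have tn : 0 < t ^+ n by exact: exprn_gt0.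
have d0 : 0 <= `|y - x| / t0 ^+ n by rewrite divr_ge0// ltW.
rewrite ge_max addr_ge0 ?bump_ge0//=.
have [lt0|ge0] := ltP t t0.
  apply: (@le_trans _ _ 0); last by rewrite addr_ge0 ?bump_ge0.
  by rewrite subr_le0 ler_pdivlMr// mul1r far// tp.
apply: (@le_trans _ _ (tube t x + `|y - x| / t0 ^+ n)); last first.
  by rewrite lerD2r tube_le_bump// tp.
have h1 : 1 - `|x - curve t| / t ^+ n <= tube t x by rewrite le_max lexx orbT.
have h2 : `|x - curve t| / t ^+ n <= `|y - curve t| / t ^+ n + `|y - x| / t ^+ n.
  rewrite -mulrDl ler_pM2r ?invr_gt0// [leRHS]addrC (distrC y x).
  exact: ler_distD.
have h3 : `|y - x| / t ^+ n <= `|y - x| / t0 ^+ n.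
  rewrite ler_wpM2l// lef_pV2 ?posrE// lerXn2r ?nnegrE ?(ltW t00)// ltW//.
lra.
Qed.

Variable M : set 'rV[R]_m.
Hypotheses (Msa : semialgebraic M) (c0 : ~ M (curve 0)).

Lemma near_curve eta : 0 < eta ->
  \forall t \near (0 : R)^'+, `|curve t - curve 0| < eta.
Proof.
move=> eta0; have : \forall t \near (0 : R)^'+, forall i, `|(c i).[t] - (c i).[0]| < eta.
  apply: filter_forall => i.
  have h : bigO 1 (fun t => (c i - (c i).[0]%:P).[t]).
    by apply: bigO_poly => -[|//] _; rewrite coefB coefC horner_coef0 subrr.
  have eta2 : 0 < eta / 2 by rewrite divr_gt0.
  apply: filterS (bigO_small eta2 h) => t; rewrite hornerD hornerN hornerC expr0.
  lra.
by apply: filterS => t h; apply/norm_ltP => // i; rewrite !mxE; exact: h.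
Qed.

(** A point x of M differs from the origin of the arc. So the points near x are
    at a distance from the beginning of the arc that is bounded below, whereas
    the radii t^n tend to 0. *)
Lemma continuous_bump : continuous (fun x : M => bump (set_val x)).
Proof.
apply/continuous_epsdelta => x e e0.
pose eta := `|set_val x - curve 0| / 4.
have eta0 : 0 < eta.
  rewrite divr_gt0// normr_gt0 subr_eq0; apply: contra_notN c0 => /eqP <-.
  exact: set_valP.
have [t0 /= t00 t0P] : exists2 t0, 0 < t0 & forall t, 0 < t < t0 ->
    `|curve t - curve 0| < eta /\ t ^+ n <= eta.
  have : \forall t \near (0 : R)^'+, `|curve t - curve 0| < eta /\ t ^+ n <= eta.
    near=> t; split; first by near: t; exact: near_curve.
    have t0 : 0 < t by near: t; exact: near0_gt0.
    have t1 : t < 1 by near: t; exact: near0_lt.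
    have te : t < eta by near: t; exact: near0_lt.
    apply: le_trans (ltW te); rewrite -[leRHS]expr1.
    by rewrite ler_wiXn2l// ltW.
  move=> /nbhs_ballP[d /= d0 dP]; exists d => // t /andP[tp td].
  by apply: dP => //; rewrite -ball_normE /ball_ /= sub0r normrN gtr0_norm.
pose d := Num.min eta (e * t0 ^+ n).
have t0n : 0 < t0 ^+ n by exact: exprn_gt0.
exists d; first by rewrite lt_min eta0 mulr_gt0.
move=> y yx; have [yeta ye] : `|set_val y - set_val x| < eta /\
    `|set_val y - set_val x| / t0 ^+ n < e.
  by move: yx; rewrite lt_min => /andP[? ?]; rewrite ltr_pdivrMr.
have far z t : `|z - set_val x| < eta -> 0 < t < t0 -> t ^+ n <= `|z - curve t|.
  move=> zx /t0P[t1 t2]; apply: (le_trans t2).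
  have : `|set_val x - curve 0| <=
      `|z - set_val x| + `|z - curve t| + `|curve t - curve 0|.
    have := ler_distD z (set_val x) (curve 0).
    by have := ler_distD (curve t) z (curve 0); rewrite (distrC z (set_val x)); lra.
  have : `|set_val x - curve 0| = eta * 4 by rewrite /eta divfK.
  by move: zx t1; lra.
have b1 := bump_lipschitz (set_val x) t00 (fun t => far _ t yeta).
have b2 : bump (set_val x) <= bump (set_val y) + `|set_val y - set_val x| / t0 ^+ n.
  rewrite distrC; apply: bump_lipschitz => // t; apply: far.
  by rewrite subrr normr0.
rewrite ltr_norml; apply/andP; split; lra.
Unshelve. all: by end_near. Qed.

(** A supremum is characterized by the numbers strictly below it. *)
Lemma graph_bump : semialgebraic (fun_graph (fun x : M => bump (set_val x))).
Proof.
apply: (sa_graph (Q := fun x z => M x /\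
    (~ (z < bump x) /\ forall w, w < z -> w < bump x))).
  move=> x z; split=> [[u [<- <-]]|[Mx [zb bz]]].
    by split; [exact: set_valP|split=> //; rewrite ltxx].
  exists (SigSub (mem_set Mx)); split=> //=.
  apply/eqP; rewrite eq_le; apply/andP; split.
    by rewrite leNgt; apply/negP => /zb.
  by rewrite leNgt; apply/negP => /bz; rewrite ltxx.
apply: definable_and.
  by apply: definable_sa => // i; exact: polynomial_var.
apply: definable_and; first exact: definable_not (definable_lt_bump m 0).
apply: definable_all; apply: definable_imp.
  by apply: definable_lt; exact: polynomial_var.
exact: (definable_lt_bump 0 1).
Qed.

Lemma Sstar_bump : Sstar M (fun x : M => bump (set_val x)).
Proof.
split; [exact: continuous_bump| |exact: graph_bump].
apply/bounded_funP; exists 1 => x.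
by rewrite ger0_norm ?bump_ge0// bump_le1.
Qed.

End Bump.

(** * Formal paths *)

Section Ramification.
Variables (R : realType) (q : nat) (q_gt0 : (0 < q)%N).
Implicit Types g : puiseux R.

Lemma power_series_ramify g : power_series 1 g -> power_series q g.
Proof. by move=> gS; have := plevel_mulq (ltnSn 0) q_gt0 gS; rewrite mul1n mul0r. Qed.

Lemma power_series_nat g :
  (forall r, g r != 0 -> r \is a Num.nat) -> power_series 1 g.
Proof.
by move=> gN r /gN/natrP[k ->]; exists k; rewrite /pexp add0r divr1 -pmulrn.
Qed.

(** With integral exponents, passing from the uniformizer t to s = t^(1/q) is
    the substitution of s^q for t. *)
Lemma trunc_ramify L g s : power_series 1 g ->
  (trunc q (q * L) g).[s] = (trunc 1 L g).[s ^+ q].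
Proof.
move=> gS; suff -> : trunc q (q * L) g = trunc 1 L g \Po 'X^q.
  by rewrite horner_comp hornerXn.
have q0 : q%:R != 0 :> rat by rewrite pnatr_eq0 -lt0n.
apply/polyP => j; rewrite coef_comp_poly_Xn// !coef_poly.
case: (boolP (q %| j)%N) => [/dvdnP[k ->]|qj].
  rewrite mulnK// [(k * q)%N]mulnC ltn_pmul2l// [(q * k)%N]mulnC; case: ifP => // _.
  by rewrite /scoef /pexp !add0r divr1 -!pmulrn natrM mulfK.
case: ifP => // _; apply/eqP/negPn/negP => /gS[k].
rewrite /pexp !add0r divr1 -!pmulrn => /(canRL (divfK q0)).
rewrite -natrM => /eqP; rewrite eqr_nat => /eqP jE.
by move: qj; rewrite jE dvdn_mull.
Qed.

Lemma exists_root_exp (t : R) : 0 < t -> exists2 s, 0 < s & s ^+ q = t.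
Proof.
move=> t0; exists (t `^ (q%:R^-1)); first exact: powR_gt0.
rewrite -powR_mulrn ?powR_ge0// -powRrM mulVf ?powRr1 ?ltW//.
by rewrite pnatr_eq0 -lt0n.
Qed.

End Ramification.

Section Paths.
Variables (R : realType) (m : nat) (M : set 'rV[R]_m) (a : 'rV[puiseux R]_m).
Hypothesis a_formal : forall i r, a ord0 i r != 0 -> r \is a Num.nat.

(** The terms of degree up to N + 1: the error is then negligible with respect
    to the radius t^N of the tubes. *)
Definition jet N (i : 'I_m) : {poly R} := trunc 1 N.+2 (a ord0 i).

Let a_series i : power_series 1 (a ord0 i).
Proof. by apply: power_series_nat; exact: a_formal. Qed.

(** The series [z] may have fractional exponents, whence the ramification index
    [q]: the real points follow the path at the parameter t = s^q. *)
Lemma path_realize (f : M -> R) z (D : R -> 'rV[R]_m -> Prop) :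
  fun_ext f a z -> (forall r, z r != 0 -> 0 <= r) -> z 0 = 0 ->
  definable (fun r => D (r 0%N) (\row_(i < m) r i.+1)) ->
  exists q K B, (0 < q)%N /\ forall N, \forall s \near (0 : R)^'+,
  exists u : M, [/\
    `|set_val u - curve (jet N) (s ^+ q)| <= s ^+ (q * N).+1,
    `|f u| <= 4^-1 & forall d, 0 < d <= s ^+ K -> (D d (set_val u) <-> B)].
Proof.
move=> faz z_ge0 z0 dD.
have [q [k [q0 zq]]] := pcoefP z.
have zS : power_series q z.
  move=> r zr; have [j rE] := zq _ zr.
  have kj : 0 <= k + j%:Z.
    have := z_ge0 _ zr; rewrite rE /pexp pmulr_lge0 ?invr_gt0 ?ltr0n//.
    by rewrite ler0z.
  by exists (absz (k + j%:Z)); rewrite rE /pexp add0r gez0_abs.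
have xS i : power_series q ((row_mx a z%:M : 'rV_(m + 1)) ord0 i).
  rewrite mxE; case: splitP => j _; first exact: power_series_ramify.
  by rewrite mxE (ord1 j) eqxx mulr1n.
pose D' d (y : 'rV[R]_(m + 1)) := D d (lsubmx y).
have dD' : definable (fun r => D' (r 0%N) (\row_(i < m + 1) r i.+1)).
  apply: definable_ext dD => r; rewrite /D'.
  suff -> : lsubmx (\row_(i < m + 1) r i.+1) = \row_(i < m) r i.+1 by [].
  by apply/rowP => i; rewrite !mxE.
have [K [B real]] := realize_vector q0 xS faz dD'.
exists q, K, B; split=> // N.
have zO : bigO 1 (fun s => (trunc q (q * N.+2) z).[s]).
  apply: bigO_poly => -[|//] _; rewrite coef_poly; case: ifP => // _.
  by rewrite /scoef /pexp addr0 mul0r.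
have e8 : 0 < 8^-1 :> R by rewrite invr_gt0.
have z8 := bigO_small e8 zO.
(* The order q (N + 2) in s corresponds to the order N + 2 in t of the jets. *)
have N'E : (q * N.+2).-1.+1 = (q * N.+2)%N by rewrite prednK// muln_gt0 q0.
have qNle : ((q * N).+1 <= (q * N.+2).-1)%N.
  by rewrite -ltnS N'E !mulnS; lia.
have := real (q * N.+2).-1; rewrite N'E.
apply: filterS3 z8 (filterI (near0_gt0 R) (near0_lt e8)) => s zs [s0 s8].
move=> [y [[u _ <-] close tail]]; exists u.
have s1 : s <= 1 by lra.
split.
- apply: norm_leP => [|i]; first by rewrite exprn_ge0// ltW.
  have := close (lshift 1 i); rewrite !(row_mxEl, mxE) trunc_ramify// => h.
  by apply: (le_trans h); rewrite ler_wiXn2l ?(ltW s0) ?qNle.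
- have := close (rshift m ord0); rewrite !(row_mxEr, mxE) eqxx !mulr1n => h.
  have h2 : s ^+ (q * N.+2).-1 <= s.
    by rewrite -[leRHS]expr1 ler_wiXn2l ?(ltW s0)// (leq_trans _ qNle).
  rewrite -[f u](subrK ((trunc q (q * N.+2) z).[s])).
  by rewrite (le_trans (ler_normD _ _))//; move: zs; rewrite expr0; lra.
- by move=> d /tail; rewrite /D' row_mxKl.
Qed.

Hypothesis Msa : semialgebraic M.

(** Let D d u say that |f| < 1/2 on the ball of radius d around u. Along the
    real points u that follow the graph of [f] above the path, f(u) tends to 0,
    so that continuity at u gives D d u for some d; by uniformity, D (s^K) u
    holds. When N > K, the ball of radius t^N = s^(q N) around the point of the
    arc of parameter t is contained in that of radius s^K around u. *)
Lemma small_near_path f : Sstar M f -> path_ideal a f ->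
  \forall N \near \oo, \forall t \near (0 : R)^'+, forall v : M,
    `|set_val v - curve (jet N) t| < t ^+ N -> `|f v| < 2^-1.
Proof.
move=> [fc _ fS] [_ [z [faz z_ge0 z0]]].
pose D d (w : 'rV[R]_m) := forall x y, takes_value f x y ->
  (forall i, - d < x ord0 i - w ord0 i /\ x ord0 i - w ord0 i < d) ->
  - 2^-1 < y /\ y < 2^-1.
have dD : definable (fun r => D (r 0%N) (\row_(i < m) r i.+1)).
  apply: definable_allv; apply: definable_all; apply: definable_imp.
    by apply: definable_takes_value => // [i|]; exact: polynomial_var.
  apply: definable_imp; last first.
    by apply: definable_and; apply: definable_lt;
      by [exact: polynomial_var|exact: polynomial_cst].
  apply: definable_forall_fin => i.
  apply: (@definable_ext _ (fun r => - r (m + 0).+1 < r i.+1 - r (m + i.+1).+1 /\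
      r i.+1 - r (m + i.+1).+1 < r (m + 0).+1)).
    by move=> r; rewrite !mxE.
  have pD : polynomial_fun (fun r : nat -> R => r i.+1 - r (m + i.+1).+1).
    by apply: polynomialD; [|apply: polynomialN]; exact: polynomial_var.
  apply: definable_and; apply: definable_lt => //; last exact: polynomial_var.
  by apply: polynomialN; exact: polynomial_var.
have DP d (u : M) : 0 < d -> D d (set_val u) <->
    forall v : M, `|set_val v - set_val u| < d -> `|f v| < 2^-1.
  move=> d0; split=> [Dd v /norm_ltP - /(_ d0) vu|h x y [v [<- <-]] vu].
    rewrite ltr_norml; apply/andP; apply: Dd (takes_value_fun f v) _ => i.
    by have := vu i; rewrite !mxE ltr_norml => /andP.
  apply/andP; rewrite -ltr_norml; apply: h; apply/norm_ltP => // i.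
  by rewrite !mxE ltr_norml; apply/andP; exact: vu.
have [q [K [B [q0 real]]]] := path_realize faz z_ge0 z0 dD.
(* One point of the family is enough to decide the truth value. *)
have BT : B.
  have [s [s0 [u [_ fu DB]]]] := filter_ex (filterI (near0_gt0 R) (real 0%N)).
  have e4 : 0 < 4^-1 :> R by rewrite invr_gt0.
  have [d0 d00 d0P] := (continuous_epsdelta f).1 fc u _ e4.
  have sK : 0 < s ^+ K by exact: exprn_gt0.
  have dm : 0 < Num.min d0 (s ^+ K) by rewrite lt_min d00.
  apply/(DB (Num.min d0 (s ^+ K))); first by rewrite dm ge_min lexx orbT.
  apply/DP => // v; rewrite lt_min => /andP[/d0P fvu _].
  rewrite -[f v](subrK (f u)) (le_lt_trans (ler_normD _ _))//; lra.
exists K.+1 => // N /= KN.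
have near_s := real N.
have [e /= e0 eP] : exists2 e, 0 < e & forall s, 0 < s < e -> s < 2^-1 /\
  exists u : M, `|set_val u - curve (jet N) (s ^+ q)| <= s ^+ (q * N).+1 /\
    D (s ^+ K) (set_val u).
  have : \forall s \near (0 : R)^'+, s < 2^-1 /\
    exists u : M, `|set_val u - curve (jet N) (s ^+ q)| <= s ^+ (q * N).+1 /\
      D (s ^+ K) (set_val u).
    have e2 : 0 < 2^-1 :> R by rewrite invr_gt0.
    apply: filterS3 (near0_gt0 R) (near0_lt e2) near_s => s s0 s2 [u [u1 _ u3]].
    split=> //; exists u; split=> //; apply/u3 => //.
    by rewrite lexx exprn_gt0.
  move=> /nbhs_ballP[d /= d0 dP]; exists d => // s /andP[sp sd].
  by apply: dP => //; rewrite -ball_normE /ball_ /= sub0r normrN gtr0_norm.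
have eq0 : 0 < e ^+ q by exact: exprn_gt0.
apply: filterS2 (near0_gt0 R) (near0_lt eq0) => t t0 te v vt.
have [s s0 sE] := exists_root_exp q0 t0.
have se : s < e.
  rewrite ltNge; apply/negP => es; move: te.
  by rewrite -sE ltNge lerXn2r// nnegrE ltW.
have [|s2 [u [uc Du]]] := eP s; first by rewrite s0.
have sK : 0 < s ^+ K by exact: exprn_gt0.
move: Du => /(DP _ _ sK); apply.
apply: (le_lt_trans (ler_distD (curve (jet N) t) _ _)).
rewrite (distrC (curve _ _)).
have qN : s ^+ (q * N) <= s ^+ K.+1.
  by rewrite ler_wiXn2l ?(leq_trans KN (leq_pmull N q0))//; lra.
have qN0 : 0 <= s ^+ (q * N) by rewrite exprn_ge0// ltW.
move: vt uc; rewrite -sE -exprM; move: qN; rewrite !exprS => qN vt uc.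
have : s * s ^+ (q * N) <= 2^-1 * s ^+ K.
  apply: (@le_trans _ _ (s ^+ (q * N))); first by rewrite ler_piMl//; lra.
  by apply: (le_trans qN); rewrite ler_pM2r//; lra.
have : s * s ^+ K <= 2^-1 * s ^+ K by rewrite ler_pM2r//; lra.
lra.
Qed.

(** Real points of M follow the path more closely than the radius of the tube,
    so the bump function is at least 1/2 there; if it belonged to the ideal, its
    values there would be at most 1/4. *)
Lemma bump_notin_path_ideal N tau : (0 < N)%N -> 0 < tau ->
  ~ path_ideal a (fun x : M => bump (jet N) N tau (set_val x)).
Proof.
move=> N0 tau0 [_ [z [faz z_ge0 z0]]].
have [q [K [B [q0 real]]]] :=
  path_realize (D := fun _ _ => True) faz z_ge0 z0 (definable_true R).
have e2 : 0 < Num.min tau 2^-1 by rewrite lt_min tau0 /= invr_gt0.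
have := filter_ex (filterI (near0_gt0 R) (filterI (near0_lt e2) (real N))).
move=> [s [s0 [s2 [u [uc ub _]]]]].
move: s2; rewrite lt_min => /andP[st s2].
pose t := s ^+ q.
have t0 : 0 < t by exact: exprn_gt0.
have tt : 0 < t <= tau.
  rewrite t0 /= (le_trans _ (ltW st))// -[leRHS]expr1.
  by rewrite ler_wiXn2l ?(ltW s0)//; lra.
have := tube_le_bump (jet N) N tau0 (set_val u) tt.
move: ub; rewrite ger0_norm ?bump_ge0// => ub.
have tN : 0 < t ^+ N by exact: exprn_gt0.
have : `|set_val u - curve (jet N) t| / t ^+ N <= s.
  by rewrite ler_pdivrMr// /t -exprM -exprS.
move=> h; rewrite /tube ge_max => /andP[_]; lra.
Qed.

End Paths.

(** * Maximal ideals and the Zariski topology *)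

Section Ideals.
Variables (R : realType) (m : nat) (M : set 'rV[R]_m) (Msa : semialgebraic M).
Implicit Types (f g h k : M -> R) (I : set (M -> R)).

Lemma maximal_not1 I : maximal_ideal_of (Sstar M) I -> ~ I 1.
Proof.
move=> [[IA I0 ID IM] InA _] I1; apply: InA; apply/seteqP; split=> // f fA.
by rewrite -[f]mulr1; exact: IM.
Qed.

Lemma maximal_comaximal I f : maximal_ideal_of (Sstar M) I -> Sstar M f -> ~ I f ->
  exists h k, [/\ Sstar M h, I k & h * f + k = 1].
Proof.
move=> [[IA I0 ID IM] InA Imax] fA nIf.
(* The ideal generated by I and f. *)
pose J : set (M -> R) := [set g | exists h k, [/\ Sstar M h, I k & g = h * f + k]].
have JA : ideal_of (Sstar M) J.
  split.
  - move=> _ [h [k [hA Ik ->]]].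
    by apply: SstarD => //; [exact: SstarM|exact: IA].
  - by exists 0, 0; split=> //; [exact: Sstar_cst|rewrite mul0r addr0].
  - move=> _ _ [h [k [hA Ik ->]]] [h' [k' [hA' Ik' ->]]].
    exists (h + h'), (k + k'); split; [exact: SstarD|exact: ID|].
    by rewrite mulrDl addrACA.
  - move=> g _ gA [h [k [hA Ik ->]]]; exists (g * h), (g * k).
    by split; [exact: SstarM|exact: IM|rewrite mulrDr mulrA].
have IJ : I `<=` J.
  by move=> k Ik; exists 0, k; split=> //; [exact: Sstar_cst|rewrite mul0r add0r].
have [JI|JS] := Imax J JA IJ.
  case: nIf; rewrite -JI; exists 1, 0; split=> //; first exact: Sstar_cst.
  by rewrite mul1r addr0.
have : J 1 by rewrite JS; exact: Sstar_cst.
by move=> [h [k [hA Ik E]]]; exists h, k.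
Qed.

(** If the ideal contained f but not g, then 1 = h g + k with k in the ideal. On
    the support of g, f is bounded below, and elsewhere k = 1; so f^2 + k^2
    would be a unit of the ring lying in the ideal. *)
Lemma maximal_support I f g e : maximal_ideal_of (Sstar M) I ->
  Sstar M g -> 0 < e -> (forall x, g x != 0 -> e <= `|f x|) ->
  I f -> I g.
Proof.
move=> Imax gA e0 fg If; apply: contrapT => nIg.
have [h [k [hA Ik hgk]]] := maximal_comaximal Imax gA nIg.
have [[IA I0 ID IM] InA _] := Imax.
pose u := f * f + k * k.
have Iu : I u by apply: ID; apply: IM => //; exact: IA.
pose c := Num.min (e ^+ 2) 1.
have c0 : 0 < c by rewrite lt_min exprn_gt0//= ltr01.
have uc x : c <= u x.
  have uE : u x = f x ^+ 2 + k x ^+ 2 by rewrite !expr2.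
  have f2 : 0 <= f x ^+ 2 by exact: sqr_ge0.
  have k2 : 0 <= k x ^+ 2 by exact: sqr_ge0.
  rewrite uE ge_min; have [gx|gx] := eqVneq (g x) 0.
    have kx : k x = 1.
      have : h x * g x + k x = 1 := congr1 (fun F => F x) hgk.
      by rewrite gx mulr0 add0r.
    by rewrite kx expr1n lerDr f2 orbT.
  apply/orP; left; rewrite -[leLHS]addr0 lerD// -[leRHS]real_normK ?num_real//.
  by rewrite lerXn2r ?nnegrE ?fg// ltW.
have uA := Sstar_inv c0 uc (IA _ Iu).
apply: (maximal_not1 Imax).
have -> : 1 = (fun x => (u x)^-1) * u.
  apply/funext => x; apply/esym; change ((u x)^-1 * u x = 1).
  by rewrite mulVf// gt_eqF// (lt_le_trans c0).
exact: IM.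
Qed.

End Ideals.

Lemma Sstar_bump_jet (R : realType) (m : nat) (M : set 'rV[R]_m)
    (a : 'rV[puiseux R]_m) N tau : semialgebraic M -> ~ M (value_at0 a) ->
  (0 < N)%N -> 0 < tau ->
  Sstar M (fun x : M => bump (jet a N) N tau (set_val x)).
Proof.
move=> Msa Ma N0 tau0; apply: Sstar_bump => //.
suff -> : curve (jet a N) 0 = value_at0 a by [].
apply/rowP => i; rewrite !mxE horner_coef0 coef_poly /=.
by rewrite /scoef /pexp addr0 mul0r.
Qed.

(** Write 1 = h f + k with k in the ideal. On a thin tube |k| < 1/2, so |f| is
    bounded below on the support of the bump function. How small tau has to be
    depends on N, because the series need not converge and its jets are not
    comparable uniformly in N. *)
Lemma bump_basis (R : realType) (m : nat) (M : set 'rV[R]_m)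
    (a : 'rV[puiseux R]_m) (I : set (M -> R)) f :
  semialgebraic M -> formal_path M a -> ~ M (value_at0 a) ->
  maximal_ideal_of (Sstar M) I -> I = path_ideal a -> Sstar M f -> ~ I f ->
  \forall N \near \oo, \forall tau \near (0 : R)^'+, forall J,
    maximal_ideal_of (Sstar M) J -> J f ->
    J (fun x : M => bump (jet a N) N tau (set_val x)).
Proof.
move=> Msa [_ a_formal] Ma Imax IE fA nIf.
have [h [k [hA Ik hfk]]] := maximal_comaximal Msa Imax fA nIf.
have kA : Sstar M k by case: Imax => -[IA _ _ _] _ _; exact: IA.
have [_ /bounded_funP[C hC] _] := hA.
have C1 : 0 < `|C| + 1 by rewrite ltr_wpDl.
move: Ik; rewrite IE => /(small_near_path a_formal kA) small.
near=> N; have N0 : (0 < N)%N by near: N; exact: nbhs_infty_gt.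
have : \forall t \near (0 : R)^'+, forall v : M,
    `|set_val v - curve (jet a N) t| < t ^+ N -> `|k v| < 2^-1 by near: N.
move=> /nbhs_ballP[d /= d0 dP].
have tubek t v : 0 < t < d -> `|set_val v - curve (jet a N) t| < t ^+ N ->
    `|k v| < 2^-1.
  move=> /andP[t0 td]; apply: (dP t) => //.
  by rewrite -ball_normE /ball_ /= sub0r normrN gtr0_norm.
near=> tau => J Jmax Jf.
have tau0 : 0 < tau by near: tau; exact: near0_gt0.
have taud : tau < d by near: tau; exact: near0_lt.
have e0 : 0 < 2^-1 / (`|C| + 1) by rewrite divr_gt0// invr_gt0.
apply: (maximal_support Msa Jmax (Sstar_bump_jet Msa Ma N0 tau0) e0 _ Jf).
move=> x /(bump_neq0 tau0)[t /andP[t0 tt] xt].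
have kx : `|k x| < 2^-1.
  by apply: tubek xt; rewrite t0 (le_lt_trans tt).
have hfx : h x * f x + k x = 1 := congr1 (fun F => F x) hfk.
have hx : `|h x| <= `|C| + 1.
  by rewrite (le_trans (hC x))// (le_trans (ler_norm C))// lerDl.
rewrite ler_pdivrMr//.
apply: (@le_trans _ _ (`|h x * f x|)); last by rewrite normrM mulrC ler_wpM2l.
have -> : h x * f x = 1 - k x by rewrite -hfx addrK.
have := lerB_dist 1 (k x); rewrite normr1; lra.
Unshelve. all: by end_near. Qed.

Lemma nbhs_beta_subbase (R : realType) (m : nat) (M : set 'rV[R]_m) (p : beta M)
    (U : set (beta M)) : nbhs p U <-> exists D : {fset (M -> R)},
  [/\ forall f, f \in D -> Sstar M f, forall f, f \in D -> ~ beta_ideal p f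
    & forall r : beta M, (forall f, f \in D -> ~ beta_ideal r f) -> U r].
Proof.
split.
  rewrite nbhsE => -[B [[DD DE BE] Bp] BU].
  move: Bp; rewrite -BE => -[C CD Cp].
  have [D DS CE] := DE _ CD.
  move: Cp; rewrite -CE => Cp.
  exists D; split.
  - by move=> f /DS fS; exact: set_mem fS.
  - by move=> f fD; exact: (Cp f).
  - move=> r Dr; apply: BU; rewrite -BE; exists C => //; rewrite -CE.
    by move=> f fD; exact: Dr.
move=> [D [DS Dp DU]]; rewrite nbhsE.
exists [set r : beta M | forall f, f \in D -> ~ beta_ideal r f]; last by [].
split=> //.
exists [set [set r : beta M | forall f, f \in D -> ~ beta_ideal r f]].
  move=> _ ->; exists D; first by move=> f /DS fS; exact: mem_set fS.
  by apply/seteqP; split.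
by rewrite bigcup_set1.
Qed.

Theorem proposition3p10 (R : realType) (m : nat) (M : set 'rV[R]_m)
    (Msa : semialgebraic M) (Mb : bounded_set M)
    (p : beta M) (pM : formal_boundary M p) :
  countable_nbhs_basis p.
Proof.
have [a [aM [_ Ma] pE]] := pM.
have a_formal : forall i r, a ord0 i r != 0 -> r \is a Num.nat by case: aM.
pose g N j : M -> R := fun x => bump (jet a N.+1) N.+1 (j.+1%:R^-1) (set_val x).
(* The exponent of the tube is N + 1, since positive exponents are needed. *)
pose V N j := [set r : beta M | ~ beta_ideal r (g N j)].
have gS N j : Sstar M (g N j).
  by apply: Sstar_bump_jet => //; rewrite invr_gt0.
exists [set V u.1 u.2 | u in [set: nat * nat]]; split.
- exact: sub_countable (card_image_le _ _) (countableP _).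
- move=> _ [[N j] _ <-]; apply/nbhs_beta_subbase; exists [fset (g N j)]%fset; split.
  + by move=> f; rewrite inE => /eqP ->.
  + move=> f; rewrite inE => /eqP ->; rewrite pE.
    by apply: bump_notin_path_ideal; rewrite ?invr_gt0.
  + by move=> r rD; apply: rD; rewrite inE.
move=> U /nbhs_beta_subbase[D [DS Dp DU]].
have near_basis : \forall N \near \oo, \forall tau \near (0 : R)^'+,
    forall f, f \in D -> forall J, maximal_ideal_of (Sstar M) J -> J f ->
    J (fun x : M => bump (jet a N) N tau (set_val x)).
  have near_f f (fD : f \in D) :=
    bump_basis Msa aM Ma (beta_idealP p) pE (DS f fD) (Dp f fD).
  apply: filterS (filter_bigI _ near_f) => N hN.
  exact: filter_bigI hN.
(* The order N0 + 1 is attained by the index N0 of the family. *)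
have [N0 _ N0P] := near_basis.
have /nbhs_ballP[d /= d0 dP] := N0P N0.+1 (leqnSn N0).
have [j jd] : exists j : nat, j.+1%:R^-1 < d.
  exists (Num.truncn d^-1); rewrite invf_plt ?posrE//.
  by rewrite truncnS_gt.
exists (V N0 j); first by exists (N0, j).
move=> r rV; apply: DU => f fD rf; apply: rV.
apply: (dP j.+1%:R^-1) fD _ (beta_idealP r) rf; last by rewrite invr_gt0.
by rewrite -ball_normE /ball_ /= sub0r normrN gtr0_norm// invr_gt0.
Qed.
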